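(* In the setting below, the intrinsic angular momentum of the cluster satisfies, as $t\nearrow T$, $$\mu^0_{\mathcal G}(t)=O(|T-t|^{7/3}),\qquad \dot\mu^0_{\mathcal G}(t)=O(|T-t|^{4/3}).$$
   Context: Setting: let $d\in\{2,3\}$, $n\ge2$, masses $m_1,\dots,m_n>0$, and let $q(t)=(q_1(t),\dots,q_n(t))$, $q_i(t)\in\mathbb{R}^d$, be a solution on $[t_0,T)$ of $m_i\ddot q_i=\partial U/\partial q_i$, $U(q)=\sum_{i<j}m_im_j/|q_i-q_j|$, with $q_i(t)\ne q_j(t)$ for $i\ne j$, $t<T$, such that every limit $L_i=\lim_{t\nearrow T}q_i(t)$ exists. Let $\mathcal G\subset\{1,\dots,n\}$ be a cluster with at least two elements: $L_i=L_j=:L_{\mathcal G}$ for $i,j\in\mathcal G$ and $L_j\neq L_{\mathcal G}$ for $j\notin\mathcal G$. $c_{\mathcal G}=(\sum_{i\in\mathcal G}m_i)^{-1}\sum_{i\in\mathcal G}m_iq_i$ and $\mu^0_{\mathcal G}=\sum_{i\in\mathcal G}m_i(q_i-c_{\mathcal G})\times(\dot q_i-\dot c_{\mathcal G})$, where for $d=2$, $a\times b=a_1b_2-a_2b_1$ and for $d=3$ it is the vector product. *)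

(* Defs.v *)
From Stdlib Require Import Reals.
From Coquelicot Require Import Coquelicot.
Open Scope R_scope.

(* Vectors of R^d are represented as functions nat -> R (coordinates k < d). *)

Fixpoint rsum (n : nat) (f : nat -> R) : R :=
  match n with
  | O => 0
  | S p => rsum p f + f p
  end.

Definition vnorm (d : nat) (a : nat -> R) : R :=
  sqrt (rsum d (fun k => (a k) ^ 2)).

(* The Newtonian force on body i divided by m_i, coordinate k:
   (1/m_i) dU/dq_i = sum_{j <> i} m_j (q_j - q_i) / |q_i - q_j|^3,
   with U(q) = sum_{i<j} m_i m_j / |q_i - q_j|. *)
Definition newton_acc (d n : nat) (m : nat -> R) (x : nat -> nat -> R)
  (i k : nat) : R :=
  rsum n (fun j =>
    if Nat.eqb j i then 0
    else m j * (x j k - x i k)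
         / (vnorm d (fun l => x i l - x j l)) ^ 3).

(* The "cross product" a x b: for d = 2 the scalar a1 b2 - a2 b1
   (stored as coordinate 0), for d = 3 the vector product.
   Coordinates are 0-based: a 0, a 1, a 2. *)
Definition cross (d : nat) (a b : nat -> R) : nat -> R :=
  match d with
  | 2%nat => fun k => if Nat.eqb k 0 then a 0%nat * b 1%nat - a 1%nat * b 0%nat else 0
  | _ => fun k =>
      match k with
      | 0%nat => a 1%nat * b 2%nat - a 2%nat * b 1%nat
      | 1%nat => a 2%nat * b 0%nat - a 0%nat * b 2%nat
      | 2%nat => a 0%nat * b 1%nat - a 1%nat * b 0%nat
      | _ => 0
      end
  end.

Definition ncross (d : nat) : nat :=
  match d with 2%nat => 1%nat | _ => 3%nat end.

Definition cmass (n : nat) (m : nat -> R) (G : nat -> bool) : R :=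
  rsum n (fun i => if G i then m i else 0).

Definition ccenter (n : nat) (m : nat -> R) (G : nat -> bool)
  (y : nat -> nat -> R) (k : nat) : R :=
  rsum n (fun i => if G i then m i * y i k else 0) / cmass n m G.

Definition mu0 (d n : nat) (m : nat -> R) (G : nat -> bool)
  (x v : nat -> nat -> R) (k : nat) : R :=
  rsum n (fun i => if G i then
    m i * cross d (fun l => x i l - ccenter n m G x l)
                  (fun l => v i l - ccenter n m G v l) k
    else 0).

(* Main.v *)
Require Import Defs.
From Stdlib Require Import Reals Lra Lia.
From Coquelicot Require Import Coquelicot.
Open Scope R_scope.

(* Write tau = T - t, and let r_i, w_i be positions and velocities relative to the center of mass
   of the cluster, I = sum m_i |r_i|^2, K and U its intrinsic kinetic energy and its potential.

   Energy.  S = sum m_i |q_i - L_i|^2 over all bodies tends to 0 and S'' = 2 K_total + O(1) by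
   Lagrange-Jacobi and energy conservation; a nonnegative function tending to 0 whose second
   derivative is bounded below has a bounded first derivative.  The cluster energy E = K - U only
   changes through the external accelerations, so |E'| <= K_total + O(1) <= S'' + O(1), and E is
   bounded although the cluster is not isolated.

   Size.  I'' = 2 K + O(1) = 2 U + O(1), and U tends to infinity, so I' <= 0.  Sundman's inequality
   I'^2 <= 8 K I makes I'^2 / sqrt I bounded, which integrates to I = O(tau^(4/3)).

   Angular momentum.  The internal torques cancel, and as sum m_i r_i = 0 only differences of
   external accelerations contribute; these are O(sqrt I), so mu' = O(I) = O(tau^(4/3)).  If mu
   failed to be O(tau^(7/3)), then |mu| would stay above some e > 0 up to time T, so that
   I'' >= 2 K - O(1) >= mu^2 / I - O(1) >= c / I, which is incompatible with I tending to 0. *)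

(** * Finite sums *)

Lemma rsum_ext n f g : (forall i, (i < n)%nat -> f i = g i) -> rsum n f = rsum n g.
Proof.
  induction n as [|n IH]; intros H; simpl; [reflexivity|].
  rewrite IH, H; auto with arith.
Qed.

Lemma rsum_plus n f g : rsum n (fun i => f i + g i) = rsum n f + rsum n g.
Proof. induction n as [|n IH]; simpl; [lra|rewrite IH; lra]. Qed.

Lemma rsum_minus n f g : rsum n (fun i => f i - g i) = rsum n f - rsum n g.
Proof. induction n as [|n IH]; simpl; [lra|rewrite IH; lra]. Qed.

Lemma rsum_scal n c f : rsum n (fun i => c * f i) = c * rsum n f.
Proof. induction n as [|n IH]; simpl; [lra|rewrite IH; lra]. Qed.

Lemma rsum_scal_r n c f : rsum n (fun i => f i * c) = rsum n f * c.
Proof. induction n as [|n IH]; simpl; [lra|rewrite IH; lra]. Qed.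

Lemma rsum_zero n : rsum n (fun _ => 0) = 0.
Proof. induction n as [|n IH]; simpl; [|rewrite IH]; lra. Qed.

Lemma rsum_eq_zero n f : (forall i, (i < n)%nat -> f i = 0) -> rsum n f = 0.
Proof. intros H. rewrite <- (rsum_zero n). now apply rsum_ext. Qed.

Lemma rsum_swap n p f :
  rsum n (fun i => rsum p (fun j => f i j)) = rsum p (fun j => rsum n (fun i => f i j)).
Proof.
  induction n as [|n IH]; simpl; [now rewrite rsum_zero|].
  now rewrite IH, <- rsum_plus.
Qed.

Lemma rsum_le n f g : (forall i, (i < n)%nat -> f i <= g i) -> rsum n f <= rsum n g.
Proof.
  induction n as [|n IH]; intros H; simpl; [lra|].
  apply Rplus_le_compat; auto with arith.
Qed.

Lemma rsum_nonneg n f : (forall i, (i < n)%nat -> 0 <= f i) -> 0 <= rsum n f.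
Proof. intros H. rewrite <- (rsum_zero n). now apply rsum_le. Qed.

Lemma rsum_term_le n f i :
  (i < n)%nat -> (forall j, (j < n)%nat -> 0 <= f j) -> f i <= rsum n f.
Proof.
  induction n as [|n IH]; intros Hi H; simpl; [lia|].
  destruct (Nat.eq_dec i n) as [->|Hin].
  - pose proof (rsum_nonneg n f ltac:(auto with arith)). lra.
  - pose proof (IH ltac:(lia) ltac:(auto with arith)).
    pose proof (H n ltac:(lia)). lra.
Qed.

(** [(C * s) ^ 2] is at most [(A * r) * (p * B)], so the arithmetic-geometric inequality bounds the
    cross term [2 * (C * s)] by [A * r + p * B]. *)
Lemma cauchy_schwarz_step A B C p r s :
  0 <= A -> 0 <= B -> 0 <= p -> 0 <= r -> C ^ 2 <= A * B -> s ^ 2 <= p * r ->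
  (C + s) ^ 2 <= (A + p) * (B + r).
Proof.
  intros HA HB Hp Hr HC Hs.
  assert (H : 2 * (C * s) <= A * r + p * B).
  { apply Rnot_lt_le. intros Hlt.
    assert (0 <= A * r) by now apply Rmult_le_pos.
    assert (0 <= p * B) by now apply Rmult_le_pos.
    assert ((A * r + p * B) ^ 2 < (2 * (C * s)) ^ 2) by nra.
    assert ((C * s) ^ 2 <= (A * B) * (p * r)).
    { replace ((C * s) ^ 2) with (C ^ 2 * s ^ 2) by ring.
      apply Rmult_le_compat; auto using pow2_ge_0. }
    pose proof (pow2_ge_0 (A * r - p * B)). nra. }
  nra.
Qed.

(** Asking only for [c i ^ 2 <= A i * B i], not for a product of two factors, lets one induction
    serve both inner products and the planar minors of angular momentum. *)
Lemma weighted_cauchy_schwarz n g A B c :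
  (forall i, (i < n)%nat -> 0 <= g i) ->
  (forall i, (i < n)%nat -> 0 <= A i) ->
  (forall i, (i < n)%nat -> 0 <= B i) ->
  (forall i, (i < n)%nat -> c i ^ 2 <= A i * B i) ->
  (rsum n (fun i => g i * c i)) ^ 2
    <= rsum n (fun i => g i * A i) * rsum n (fun i => g i * B i).
Proof.
  induction n as [|n IH]; intros Hg HA HB Hc; simpl rsum; [lra|].
  apply cauchy_schwarz_step.
  - apply rsum_nonneg. intros; apply Rmult_le_pos; auto with arith.
  - apply rsum_nonneg. intros; apply Rmult_le_pos; auto with arith.
  - apply Rmult_le_pos; auto with arith.
  - apply Rmult_le_pos; auto with arith.
  - apply IH; auto with arith.
  - pose proof (Hc n ltac:(lia)) as H. pose proof (pow2_ge_0 (g n)). nra.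
Qed.

(** Exchange the names [i] and [j] and average the two forms of the sum. This is how Newton's third
    law enters. *)
Lemma rsum_antisym n A x y :
  (forall i j, A i j = A j i) ->
  rsum n (fun i => rsum n (fun j => A i j * (x i * (y j - y i))))
  = - / 2 * rsum n (fun i => rsum n (fun j => A i j * ((x i - x j) * (y i - y j)))).
Proof.
  intros HA.
  set (P := rsum n (fun i => rsum n (fun j => A i j * (x i * (y j - y i))))).
  assert (H : P = rsum n (fun i => rsum n (fun j => A i j * (x j * (y i - y j))))).
  { unfold P. rewrite rsum_swap.
    apply rsum_ext; intros i _. apply rsum_ext; intros j _. now rewrite HA. }
  assert (H2 : P + P = - rsum n (fun i => rsum n (fun j => A i j * ((x i - x j) * (y i - y j))))).
  { rewrite H at 2. unfold P. rewrite <- rsum_plus.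
    replace (- _) with (-1 * rsum n (fun i => rsum n (fun j => A i j * ((x i - x j) * (y i - y j)))))
      by ring.
    rewrite <- rsum_scal. apply rsum_ext; intros i _.
    rewrite <- rsum_plus, <- rsum_scal. apply rsum_ext; intros j _. ring. }
  lra.
Qed.

(** * Derivatives and norms *)

Lemma is_derive_rsum n (f : nat -> R -> R) (df : nat -> R) (t : R) :
  (forall i, (i < n)%nat -> is_derive (f i) t (df i)) ->
  is_derive (fun s => rsum n (fun i => f i s)) t (rsum n df).
Proof.
  induction n as [|n IH]; intros H; simpl.
  - apply (is_derive_const 0).
  - apply (is_derive_plus (fun s => rsum n (fun i => f i s))); auto with arith.
Qed.

Lemma is_derive_Rmult (f g : R -> R) (t df dg : R) :
  is_derive f t df -> is_derive g t dg ->
  is_derive (fun s => f s * g s) t (df * g t + f t * dg).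
Proof. intros Hf Hg. apply (is_derive_mult f g); auto. intros; apply Rmult_comm. Qed.

Lemma is_derive_eq (f : R -> R) (t a b : R) : is_derive f t a -> a = b -> is_derive f t b.
Proof. now intros H <-. Qed.

Lemma vnorm_sqr d a : vnorm d a * vnorm d a = rsum d (fun k => a k ^ 2).
Proof. apply sqrt_sqrt. apply rsum_nonneg. intros; apply pow2_ge_0. Qed.

Lemma Rabs_le_vnorm d a k : (k < d)%nat -> Rabs (a k) <= vnorm d a.
Proof.
  intros Hk. rewrite <- sqrt_Rsqr_abs. apply sqrt_le_1_alt.
  rewrite Rsqr_pow2. apply (rsum_term_le d (fun k => a k ^ 2)); auto.
  intros; apply pow2_ge_0.
Qed.

Lemma vnorm_sub_comm d (a b : nat -> R) :
  vnorm d (fun k => a k - b k) = vnorm d (fun k => b k - a k).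
Proof. unfold vnorm. f_equal. apply rsum_ext. intros; ring. Qed.

Lemma vnorm_pos d a k : (k < d)%nat -> a k <> 0 -> 0 < vnorm d a.
Proof.
  intros Hk Ha. apply Rlt_le_trans with (Rabs (a k)).
  - now apply Rabs_pos_lt.
  - now apply Rabs_le_vnorm.
Qed.

Lemma is_derive_inv_vnorm d (x : nat -> R -> R) (v : nat -> R) (t : R) :
  (forall k, (k < d)%nat -> is_derive (x k) t (v k)) ->
  0 < vnorm d (fun k => x k t) ->
  is_derive (fun s => / vnorm d (fun k => x k s)) t
    (- rsum d (fun k => x k t * v k) / vnorm d (fun k => x k t) ^ 3).
Proof.
  intros Hx Hpos.
  assert (HD : is_derive (fun s => rsum d (fun k => x k s ^ 2)) t
                 (2 * rsum d (fun k => x k t * v k))).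
  { rewrite <- rsum_scal.
    apply (is_derive_rsum d (fun k s => x k s ^ 2)). intros k Hk.
    apply (is_derive_ext (fun s => x k s * x k s)); [intros s; change (x k s * x k s = x k s ^ 2); ring|].
    eapply is_derive_eq; [apply is_derive_Rmult; apply Hx, Hk|]. ring. }
  assert (Hsum : 0 < rsum d (fun k => x k t ^ 2)).
  { rewrite <- vnorm_sqr. nra. }
  pose proof (is_derive_sqrt _ _ _ HD Hsum) as Hs.
  change (is_derive (fun s => vnorm d (fun k => x k s)) t
    (2 * rsum d (fun k => x k t * v k) / (2 * vnorm d (fun k => x k t)))) in Hs.
  eapply is_derive_eq; [apply (is_derive_inv _ _ _ Hs); lra|].
  simpl; field. lra.
Qed.

(** * Limits and Landau estimates at the left of T *)

Lemma at_left_iff T P :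
  at_left T P <-> exists t1, t1 < T /\ forall t, t1 < t < T -> P t.
Proof.
  split.
  - intros [e He]. exists (T - e). pose proof (cond_pos e). split; [lra|].
    intros t Ht. apply He; [|lra].
    change (Rabs (t - T) < e). rewrite Rabs_left; lra.
  - intros (t1 & H1 & H). assert (He : 0 < T - t1) by lra.
    exists (mkposreal _ He). intros t Ht Hlt. apply H. split; [|lra].
    change (Rabs (t - T) < T - t1) in Ht. rewrite Rabs_left in Ht; lra.
Qed.

Lemma at_left_gt T a : a < T -> at_left T (fun t => a < t < T).
Proof. intros H. apply at_left_iff. now exists a. Qed.

Lemma at_left_lim_lt T (f : R -> R) (l e : R) : filterlim f (at_left T) (locally l) -> 0 < e ->
  at_left T (fun t => Rabs (f t - l) < e).
Proof. intros H He. exact (proj1 (filterlim_locally f l) H (mkposreal e He)). Qed.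

Lemma lim_plus T (f g : R -> R) (a b : R) :
  filterlim f (at_left T) (locally a) -> filterlim g (at_left T) (locally b) ->
  filterlim (fun t => f t + g t) (at_left T) (locally (a + b)).
Proof.
  intros Hf Hg.
  exact (filterlim_comp_2 f g plus Hf Hg (filterlim_plus a b)).
Qed.

Lemma lim_mult T (f g : R -> R) (a b : R) :
  filterlim f (at_left T) (locally a) -> filterlim g (at_left T) (locally b) ->
  filterlim (fun t => f t * g t) (at_left T) (locally (a * b)).
Proof.
  intros Hf Hg.
  exact (filterlim_comp_2 f g mult Hf Hg (filterlim_mult a b)).
Qed.

Lemma lim_const T (c : R) : filterlim (fun _ : R => c) (at_left T) (locally c).
Proof. apply filterlim_const. Qed.

Lemma lim_eq T (f : R -> R) (a b : R) :
  filterlim f (at_left T) (locally a) -> a = b -> filterlim f (at_left T) (locally b).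
Proof. now intros H <-. Qed.

Lemma lim_minus T (f g : R -> R) (a b : R) :
  filterlim f (at_left T) (locally a) -> filterlim g (at_left T) (locally b) ->
  filterlim (fun t => f t - g t) (at_left T) (locally (a - b)).
Proof.
  intros Hf Hg.
  apply (filterlim_ext (fun t => f t + (-1) * g t)); [intros; ring|].
  apply lim_eq with (a + (-1) * b); [|ring].
  apply lim_plus; [assumption|]. apply lim_mult; [apply lim_const|assumption].
Qed.

Lemma lim_rsum T n (f : nat -> R -> R) (a : nat -> R) :
  (forall i, (i < n)%nat -> filterlim (f i) (at_left T) (locally (a i))) ->
  filterlim (fun t => rsum n (fun i => f i t)) (at_left T) (locally (rsum n a)).
Proof.
  induction n as [|n IH]; intros H; simpl.
  - apply lim_const.
  - apply (lim_plus T (fun t => rsum n (fun i => f i t))); auto with arith.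
Qed.

(** Neither [C] nor [h] carries a sign condition; where monotonicity in the constant matters, proofs
    pass to [Rabs C]. *)
Definition big_o (T : R) (f h : R -> R) : Prop :=
  exists C, at_left T (fun t => Rabs (f t) <= C * h t).

Lemma big_o_ext_loc T (f g h : R -> R) :
  at_left T (fun t => f t = g t) -> big_o T f h -> big_o T g h.
Proof.
  intros He [C H]. exists C. generalize (filter_and _ _ He H).
  apply filter_imp. now intros t [<- Ht].
Qed.

Lemma big_o_ext T (f g h : R -> R) : (forall t, f t = g t) -> big_o T f h -> big_o T g h.
Proof. intros He. apply big_o_ext_loc. now apply filter_forall. Qed.

Lemma big_o_plus T (f g h : R -> R) :
  big_o T f h -> big_o T g h -> big_o T (fun t => f t + g t) h.
Proof.
  intros [C1 H1] [C2 H2]. exists (C1 + C2). generalize (filter_and _ _ H1 H2).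
  apply filter_imp. intros t [H3 H4].
  pose proof (Rabs_triang (f t) (g t)). lra.
Qed.

Lemma big_o_minus T (f g h : R -> R) :
  big_o T f h -> big_o T g h -> big_o T (fun t => f t - g t) h.
Proof.
  intros [C1 H1] [C2 H2]. exists (C1 + C2). generalize (filter_and _ _ H1 H2).
  apply filter_imp. intros t [H3 H4].
  pose proof (Rabs_triang (f t) (- g t)). rewrite Rabs_Ropp in *.
  unfold Rminus. lra.
Qed.

Lemma big_o_mult T (f g h k : R -> R) :
  big_o T f h -> big_o T g k -> big_o T (fun t => f t * g t) (fun t => h t * k t).
Proof.
  intros [C1 H1] [C2 H2]. exists (C1 * C2). generalize (filter_and _ _ H1 H2).
  apply filter_imp. intros t [H3 H4]. rewrite Rabs_mult.
  replace (C1 * C2 * (h t * k t)) with ((C1 * h t) * (C2 * k t)) by ring.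
  apply Rmult_le_compat; auto using Rabs_pos.
Qed.

Lemma big_o_weaken T (f h k : R -> R) : (forall t, h t = k t) -> big_o T f h -> big_o T f k.
Proof.
  intros E [C H]. exists C. revert H. apply filter_imp. intros t. now rewrite E.
Qed.

Lemma big_o_mult_1l T (f g h : R -> R) :
  big_o T f (fun _ => 1) -> big_o T g h -> big_o T (fun t => f t * g t) h.
Proof.
  intros H1 H2. apply big_o_weaken with (fun t => 1 * h t); [intros; ring|].
  now apply big_o_mult.
Qed.

Lemma big_o_mult_1r T (f g h : R -> R) :
  big_o T f h -> big_o T g (fun _ => 1) -> big_o T (fun t => f t * g t) h.
Proof.
  intros H1 H2. apply big_o_weaken with (fun t => h t * 1); [intros; ring|].
  now apply big_o_mult.
Qed.

Lemma big_o_const T c : big_o T (fun _ => c) (fun _ => 1).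
Proof. exists (Rabs c). apply filter_forall. intros; lra. Qed.

Lemma big_o_zero T h : big_o T (fun _ => 0) h.
Proof. exists 0. apply filter_forall. intros. rewrite Rabs_R0. lra. Qed.

Lemma big_o_lim T (f : R -> R) (l : R) : filterlim f (at_left T) (locally l) -> big_o T f (fun _ => 1).
Proof.
  intros H. exists (Rabs l + 1). generalize (at_left_lim_lt T f l 1 H Rlt_0_1).
  apply filter_imp. intros t Ht.
  pose proof (Rabs_triang (f t - l) l).
  replace (f t - l + l) with (f t) in H0 by ring. lra.
Qed.

Lemma big_o_rsum T n (f : nat -> R -> R) h :
  (forall i, (i < n)%nat -> big_o T (f i) h) -> big_o T (fun t => rsum n (fun i => f i t)) h.
Proof.
  induction n as [|n IH]; intros H; simpl.
  - apply big_o_zero.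
  - apply (big_o_plus T (fun t => rsum n (fun i => f i t))); auto with arith.
Qed.

Lemma big_o_mult_diff T (f f' g g' h : R -> R) :
  big_o T f (fun _ => 1) -> big_o T g' (fun _ => 1) ->
  big_o T (fun t => f t - f' t) h -> big_o T (fun t => g t - g' t) h ->
  big_o T (fun t => f t * g t - f' t * g' t) h.
Proof.
  intros Hf Hg' Hff Hgg.
  apply big_o_ext with (fun t => f t * (g t - g' t) + (f t - f' t) * g' t); [intros; ring|].
  apply big_o_plus; [now apply big_o_mult_1l|now apply big_o_mult_1r].
Qed.

Lemma big_o_le T (f g h : R -> R) :
  at_left T (fun t => Rabs (f t) <= Rabs (g t)) -> big_o T g h -> big_o T f h.
Proof.
  intros Hle [C H]. exists C. generalize (filter_and _ _ Hle H).
  apply filter_imp. intros t [H1 H2]. lra.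
Qed.

Lemma big_o_trans T (f g h : R -> R) : big_o T f g -> big_o T g h -> big_o T f h.
Proof.
  intros [C1 H1] [C2 H2]. exists (Rabs C1 * C2). generalize (filter_and _ _ H1 H2).
  apply filter_imp. intros t [H3 H4].
  assert (C1 * g t <= Rabs C1 * Rabs (g t)).
  { rewrite <- Rabs_mult. apply Rle_abs. }
  assert (Rabs C1 * Rabs (g t) <= Rabs C1 * (C2 * h t))
    by (apply Rmult_le_compat_l; [apply Rabs_pos|assumption]).
  lra.
Qed.

Lemma big_o_scal T c (f h : R -> R) : big_o T f h -> big_o T (fun t => c * f t) h.
Proof. intros H. apply big_o_mult_1l; [apply big_o_const|assumption]. Qed.

(** The theorem fixes its constant before the coordinate [k]; bounding the sum of all absolute
    values gives one constant for all coordinates. *)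
Lemma big_o_uniform T N (f : nat -> R -> R) (h : R -> R) :
  (forall k, (k < N)%nat -> big_o T (f k) h) ->
  exists C, at_left T (fun t => forall k, (k < N)%nat -> Rabs (f k t) <= C * h t).
Proof.
  intros H.
  assert (HS : big_o T (fun t => rsum N (fun k => Rabs (f k t))) h).
  { apply (big_o_rsum T N (fun k t => Rabs (f k t))). intros k Hk.
    apply big_o_le with (f k); [|auto]. apply filter_forall. intros t. rewrite Rabs_Rabsolu. lra. }
  destruct HS as [C HC]. exists C. revert HC. apply filter_imp. intros t Ht k Hk.
  pose proof (rsum_term_le N (fun k => Rabs (f k t)) k Hk ltac:(intros; apply Rabs_pos)).
  pose proof (Rle_abs (rsum N (fun k => Rabs (f k t)))). cbv beta in *. lra.
Qed.

Lemma at_left_ex T a P : a < T -> at_left T P -> exists s, a < s < T /\ P s.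
Proof.
  intros Ha H. apply at_left_iff in H as (t1 & H1 & H).
  exists ((Rmax a t1 + T) / 2).
  assert (Rmax a t1 < T) by now apply Rmax_lub_lt.
  pose proof (Rmax_l a t1). pose proof (Rmax_r a t1).
  split; [lra|apply H; lra].
Qed.

(** * Differential inequalities *)

Lemma nondecreasing_of_derive (f df : R -> R) a b :
  a <= b -> (forall t, a <= t <= b -> is_derive f t (df t)) ->
  (forall t, a <= t <= b -> 0 <= df t) -> f a <= f b.
Proof.
  intros Hab Hf Hdf.
  destruct (MVT_gen f a b df) as (c & Hc & E).
  - intros x. rewrite Rmin_left, Rmax_right by lra. intros; apply Hf; lra.
  - intros x. rewrite Rmin_left, Rmax_right by lra. intros Hx.
    apply continuity_pt_filterlim.
    apply (@ex_derive_continuous R_AbsRing R_NormedModule f x). exists (df x). now apply Hf.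
  - rewrite Rmin_left, Rmax_right in Hc by lra.
    pose proof (Hdf c Hc). assert (0 <= df c * (b - a)) by (apply Rmult_le_pos; lra). lra.
Qed.

Lemma nonincreasing_of_derive (f df : R -> R) a b :
  a <= b -> (forall t, a <= t <= b -> is_derive f t (df t)) ->
  (forall t, a <= t <= b -> df t <= 0) -> f b <= f a.
Proof.
  intros Hab Hf Hdf.
  enough (- f a <= - f b) by lra.
  apply (nondecreasing_of_derive (fun t => - f t) (fun t => - df t)); auto.
  - intros t Ht. apply (is_derive_opp f t (df t)); auto.
  - intros t Ht. pose proof (Hdf t Ht). lra.
Qed.

Lemma is_derive_affine_add (f : R -> R) (k t df : R) :
  is_derive f t df -> is_derive (fun s => f s + k * s) t (df + k).
Proof.
  intros Hf. apply (is_derive_plus f (fun s => k * s) t df k); [assumption|].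
  eapply is_derive_eq; [apply is_derive_scal, is_derive_id|].
  change (k * 1 = k). ring.
Qed.

(* If f' exceeded C (T - t), then f would increase up to time T and could not tend to 0. *)
Lemma derive_le_of_lim_zero (f f1 f2 : R -> R) t1 T C :
  0 <= C ->
  (forall t, t1 < t < T -> is_derive f t (f1 t)) ->
  (forall t, t1 < t < T -> is_derive f1 t (f2 t)) ->
  (forall t, t1 < t < T -> 0 <= f t) ->
  (forall t, t1 < t < T -> - C <= f2 t) ->
  filterlim f (at_left T) (locally 0) ->
  forall t, t1 < t < T -> f1 t <= C * (T - t).
Proof.
  intros HC Hf Hf1 Hpos Hf2 Hlim t Ht. apply Rnot_lt_le; intros Hlt.
  set (e := f1 t - C * (T - t)).
  assert (He : 0 < e) by (unfold e; lra).
  assert (Hge : forall s, t <= s < T -> e <= f1 s).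
  { intros s Hs.
    assert (f1 t + C * t <= f1 s + C * s).
    { apply (nondecreasing_of_derive (fun r => f1 r + C * r) (fun r => f2 r + C)); [lra| |].
      - intros r Hr. apply is_derive_affine_add, Hf1. lra.
      - intros r Hr. pose proof (Hf2 r ltac:(lra)). lra. }
    assert (C * s <= C * T) by (apply Rmult_le_compat_l; lra).
    unfold e. lra. }
  set (s0 := (t + T) / 2). assert (Hs0 : t < s0 < T) by (unfold s0; lra).
  assert (Hd : 0 < e * (s0 - t)) by (apply Rmult_lt_0_compat; lra).
  destruct (at_left_ex T s0 _ ltac:(lra) (at_left_lim_lt _ _ _ _ Hlim Hd)) as (s & Hs & Hfs).
  rewrite Rminus_0_r in Hfs. pose proof (Rle_abs (f s)).
  assert (f t + (- e) * t <= f s + (- e) * s).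
  { apply (nondecreasing_of_derive (fun r => f r + (- e) * r) (fun r => f1 r + - e)); [lra| |].
    - intros r Hr. apply is_derive_affine_add, Hf. lra.
    - intros r Hr. pose proof (Hge r ltac:(lra)). lra. }
  pose proof (Hpos t Ht).
  assert (e * (s0 - t) <= e * (s - t)) by (apply Rmult_le_compat_l; lra).
  lra.
Qed.

(** The upper bound is [derive_le_of_lim_zero]; the lower one holds because [f1 t + C * t] is
    nondecreasing. *)
Lemma derive_bounded_of_lim_zero (f f1 f2 : R -> R) t1 T C :
  t1 < T -> 0 <= C ->
  (forall t, t1 < t < T -> is_derive f t (f1 t)) ->
  (forall t, t1 < t < T -> is_derive f1 t (f2 t)) ->
  (forall t, t1 < t < T -> 0 <= f t) ->
  (forall t, t1 < t < T -> - C <= f2 t) ->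
  filterlim f (at_left T) (locally 0) ->
  big_o T f1 (fun _ => 1).
Proof.
  intros HT HC Hf Hf1 Hpos Hf2 Hlim.
  set (t2 := (t1 + T) / 2). assert (Ht2 : t1 < t2 < T) by (unfold t2; lra).
  exists (Rabs (f1 t2) + C * (T - t2)).
  apply at_left_iff. exists t2. split; [lra|]. intros t Ht.
  pose proof (derive_le_of_lim_zero f f1 f2 t1 T C HC Hf Hf1 Hpos Hf2 Hlim t ltac:(lra)).
  assert (f1 t2 + C * t2 <= f1 t + C * t).
  { apply (nondecreasing_of_derive (fun r => f1 r + C * r) (fun r => f2 r + C)); [lra| |].
    - intros r Hr. apply is_derive_affine_add, Hf1. lra.
    - intros r Hr. pose proof (Hf2 r ltac:(lra)). lra. }
  assert (C * t <= C * T) by (apply Rmult_le_compat_l; lra).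
  assert (C * t2 <= C * t) by (apply Rmult_le_compat_l; lra).
  pose proof (Rcomplements.Rabs_maj2 (f1 t2)). pose proof (Rabs_pos (f1 t2)).
  rewrite Rmult_1_r. apply Rabs_le. lra.
Qed.

(** Both [g + f + C * t] and [g - f + C * t] are nondecreasing, so a bounded [g] confines [f] from
    both sides even if [g1] blows up at [T]. *)
Lemma bounded_of_derive_dominated (f f1 g g1 : R -> R) t1 T C :
  t1 < T ->
  (forall t, t1 < t < T -> is_derive f t (f1 t)) ->
  (forall t, t1 < t < T -> is_derive g t (g1 t)) ->
  (forall t, t1 < t < T -> Rabs (f1 t) <= g1 t + C) ->
  big_o T g (fun _ => 1) -> big_o T f (fun _ => 1).
Proof.
  intros HT Hf Hg Hle [B HB]. apply at_left_iff in HB as (t3 & Ht3 & HB).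
  set (t2 := (Rmax t1 t3 + T) / 2).
  assert (Rmax t1 t3 < T) by now apply Rmax_lub_lt.
  pose proof (Rmax_l t1 t3). pose proof (Rmax_r t1 t3).
  assert (Ht2 : t1 < t2 < T /\ t3 < t2) by (unfold t2; lra).
  exists (Rabs (f t2) + 2 * B + Rabs C * (T - t2)).
  apply at_left_iff. exists t2. split; [lra|]. intros t Ht.
  assert (Hmon : forall e, e ^ 2 = 1 ->
    (g t2 + e * f t2) + C * t2 <= (g t + e * f t) + C * t).
  { intros e He.
    apply (nondecreasing_of_derive (fun s => (g s + e * f s) + C * s)
                                   (fun s => (g1 s + e * f1 s) + C)); [lra| |].
    - intros s Hs. apply is_derive_affine_add.
      apply (is_derive_plus g (fun s => e * f s)); [apply Hg; lra|].
      apply is_derive_scal, Hf. lra.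
    - intros s Hs. pose proof (Hle s ltac:(lra)) as H2. apply Rabs_le_between in H2.
      assert (e = 1 \/ e = -1) as [->| ->] by nra; lra. }
  pose proof (Hmon 1 ltac:(ring)). pose proof (Hmon (-1) ltac:(ring)).
  pose proof (HB t ltac:(lra)) as H4. pose proof (HB t2 ltac:(lra)) as H5.
  apply Rabs_le_between in H4. apply Rabs_le_between in H5.
  pose proof (Rle_abs (f t2)). pose proof (Rcomplements.Rabs_maj2 (f t2)).
  assert (C * (t - t2) <= Rabs C * (T - t2)).
  { apply Rle_trans with (Rabs C * (t - t2)).
    - apply Rmult_le_compat_r; [lra|apply Rle_abs].
    - apply Rmult_le_compat_l; [apply Rabs_pos|lra]. }
  rewrite Rmult_1_r in *. apply Rabs_le. lra.
Qed.

Lemma lim_sqrt_zero T (f : R -> R) :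
  filterlim f (at_left T) (locally 0) -> filterlim (fun t => sqrt (f t)) (at_left T) (locally 0).
Proof.
  intros H. apply lim_eq with (sqrt 0); [|apply sqrt_0].
  apply (filterlim_comp _ _ _ f sqrt _ (locally 0)); [assumption|].
  apply (continuous_sqrt 0).
Qed.

(* Sundman's function I'^2 / sqrt I + 4 C sqrt I is nonincreasing, hence |I'| <= const * I^(1/4),
   which integrates to I^(3/4) <= const * (T - t). *)
Lemma inertia_upper_bound (I I1 I2 : R -> R) t1 T C :
  t1 < T -> 0 <= C ->
  (forall t, t1 < t < T -> is_derive I t (I1 t)) ->
  (forall t, t1 < t < T -> is_derive I1 t (I2 t)) ->
  (forall t, t1 < t < T -> 0 < I t) ->
  (forall t, t1 < t < T -> I1 t <= 0) ->
  (forall t, t1 < t < T -> I1 t ^ 2 <= 4 * I t * (I2 t + C)) ->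
  filterlim I (at_left T) (locally 0) ->
  big_o T I (fun t => Rpower (T - t) (4 / 3)).
Proof.
  intros HT HC HI HI1 Hpos Hneg Hsund Hlim.
  set (t2 := (t1 + T) / 2). assert (Ht2 : t1 < t2 < T) by (unfold t2; lra).
  set (F := fun t => I1 t ^ 2 / sqrt (I t) + 4 * C * sqrt (I t)).
  assert (HR : forall t, t1 < t < T -> 0 < sqrt (I t)) by (intros; apply sqrt_lt_R0; auto).
  assert (HRsq : forall t, t1 < t < T -> sqrt (I t) * sqrt (I t) = I t).
  { intros t Ht. apply sqrt_sqrt. left. auto. }
  assert (HdR : forall t, t1 < t < T -> is_derive (fun s => sqrt (I s)) t (I1 t / (2 * sqrt (I t)))).
  { intros t Ht. apply is_derive_sqrt; auto. }
  assert (HF : forall t, t2 <= t < T -> F t <= F t2).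
  { intros t Ht.
    (* This is [F'] in factored form: the first factor is nonpositive by the sign of [I1], the
       second nonnegative by the Sundman hypothesis. *)
    apply (nonincreasing_of_derive F (fun t => I1 t / sqrt (I t) *
            (2 * I2 t - I1 t ^ 2 / (2 * I t) + 2 * C))); [lra| |].
    - intros s Hs. pose proof (HR s ltac:(lra)) as HRs.
      pose proof (HRsq s ltac:(lra)) as HRs2.
      assert (HsqI1 : is_derive (fun s => I1 s ^ 2) s (2 * I1 s * I2 s)).
      { apply (is_derive_ext (fun s => I1 s * I1 s)).
        - intros r. change (I1 r * I1 r = I1 r ^ 2). ring.
        - eapply is_derive_eq; [apply is_derive_Rmult; apply HI1; lra|]. ring. }
      unfold F. eapply is_derive_eq.
      + apply (is_derive_plus (fun s => I1 s ^ 2 / sqrt (I s)) (fun s => 4 * C * sqrt (I s))).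
        * apply is_derive_div; [exact HsqI1|apply HdR; lra|lra].
        * apply is_derive_scal, HdR. lra.
      + match goal with |- plus ?a ?b = ?c => change (a + b = c) end.
        replace (2 * I s) with (2 * (sqrt (I s) * sqrt (I s))) by (now rewrite HRs2).
        field. lra.
    - intros s Hs. pose proof (HR s ltac:(lra)) as HRs.
      pose proof (Hneg s ltac:(lra)). pose proof (Hpos s ltac:(lra)) as HIs.
      assert (0 <= - I1 s / sqrt (I s)) by (apply Rdiv_le_0_compat; lra).
      assert (I1 s ^ 2 / (2 * I s) <= 2 * I2 s + 2 * C).
      { apply Rmult_le_reg_r with (2 * I s); [lra|].
        replace (I1 s ^ 2 / (2 * I s) * (2 * I s)) with (I1 s ^ 2) by (field; lra).
        pose proof (Hsund s ltac:(lra)). lra. }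
      assert (0 <= (- I1 s / sqrt (I s)) * (2 * I2 s - I1 s ^ 2 / (2 * I s) + 2 * C))
        by (apply Rmult_le_pos; lra).
      replace (I1 s / sqrt (I s)) with (- (- I1 s / sqrt (I s))) by (field; lra). lra. }
  set (B := F t2).
  assert (HB : forall t, t2 <= t < T -> I1 t ^ 2 <= B * sqrt (I t)).
  { intros t Ht. pose proof (HF t Ht) as H. fold B in H. unfold F in H.
    pose proof (HR t ltac:(lra)) as HRt.
    assert (0 <= 4 * C * sqrt (I t)) by (apply Rmult_le_pos; lra).
    apply Rmult_le_reg_r with (/ sqrt (I t)); [now apply Rinv_0_lt_compat|].
    replace (B * sqrt (I t) * / sqrt (I t)) with B by (field; lra).
    unfold Rdiv in H. lra. }
  (* [P] is [I] to the power 3/4. Its derivative is 3/4 of [I1] divided by the fourth root of [I],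
     which the bound [HB] keeps above [- 3 / 4 * sqrt B]. *)
  set (P := fun t => sqrt (I t) * sqrt (sqrt (I t))).
  (* The summand 1 makes [k] strictly positive, so that [Rpower] can be distributed over
     [k * (T - t)]. *)
  set (k := 3 / 4 * sqrt B + 1).
  assert (Hk : 0 < k) by (unfold k; pose proof (sqrt_pos B); lra).
  assert (HPmon : forall t s, t2 <= t <= s -> s < T -> P t + k * t <= P s + k * s).
  { intros t s Hts HsT.
    apply (nondecreasing_of_derive (fun t => P t + k * t)
             (fun t => 3 / 4 * (I1 t / sqrt (sqrt (I t))) + k)); [lra| |].
    - intros r Hr. apply is_derive_affine_add.
      pose proof (HR r ltac:(lra)) as HRr.
      assert (HQ : 0 < sqrt (sqrt (I r))) by now apply sqrt_lt_R0.
      assert (HQ2 : sqrt (sqrt (I r)) * sqrt (sqrt (I r)) = sqrt (I r)) by (apply sqrt_sqrt; lra).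
      eapply is_derive_eq.
      + apply (is_derive_Rmult (fun t => sqrt (I t)) (fun t => sqrt (sqrt (I t)))).
        * apply HdR; lra.
        * apply is_derive_sqrt; [apply HdR; lra|assumption].
      + rewrite <- HQ2 at 1 3 4. field. lra.
    - intros r Hr.
      pose proof (HR r ltac:(lra)) as HRr.
      assert (HQ : 0 < sqrt (sqrt (I r))) by now apply sqrt_lt_R0.
      assert (Hle : - sqrt B * sqrt (sqrt (I r)) <= I1 r).
      { assert (Rabs (I1 r) <= sqrt B * sqrt (sqrt (I r))).
        { rewrite <- sqrt_Rsqr_abs, <- sqrt_mult_alt.
          - apply sqrt_le_1_alt. rewrite Rsqr_pow2. apply HB. lra.
          (* [B] is nonnegative because [B * sqrt (I r)] dominates a square. *)
          - apply Rmult_le_reg_r with (sqrt (I r)); [assumption|].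
            pose proof (HB r ltac:(lra)). pose proof (pow2_ge_0 (I1 r)). lra. }
        apply Rabs_le_between in H. lra. }
      assert (- sqrt B <= I1 r / sqrt (sqrt (I r))).
      { apply Rmult_le_reg_r with (sqrt (sqrt (I r))); [assumption|].
        replace (I1 r / sqrt (sqrt (I r)) * sqrt (sqrt (I r))) with (I1 r) by (field; lra).
        assumption. }
      unfold k. lra. }
  assert (HPlim : filterlim P (at_left T) (locally 0)).
  { apply lim_eq with (0 * 0); [|ring].
    apply (lim_mult T (fun t => sqrt (I t)) (fun t => sqrt (sqrt (I t)))).
    - now apply lim_sqrt_zero.
    - now apply (lim_sqrt_zero T (fun t => sqrt (I t))), lim_sqrt_zero. }
  assert (HP : forall t, t2 <= t < T -> P t <= k * (T - t)).
  { intros t Ht. apply le_epsilon. intros e He.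
    destruct (at_left_ex T t _ ltac:(lra) (at_left_lim_lt _ _ _ _ HPlim He)) as (s & Hs & HPs).
    rewrite Rminus_0_r in HPs. pose proof (Rle_abs (P s)).
    pose proof (HPmon t s ltac:(lra) ltac:(lra)).
    assert (k * s <= k * T) by (apply Rmult_le_compat_l; lra). lra. }
  exists (Rpower k (4 / 3)). apply at_left_iff. exists t2. split; [lra|].
  intros t Ht. pose proof (HR t ltac:(lra)) as HRt.
  rewrite Rabs_pos_eq by (left; apply Hpos; lra).
  assert (EP : P t = Rpower (sqrt (I t)) (3 / 2)).
  { unfold P. replace (3 / 2) with (1 + / 2) by lra.
    now rewrite Rpower_plus, Rpower_1, Rpower_sqrt. }
  assert (EI : I t = Rpower (P t) (4 / 3)).
  { rewrite EP, Rpower_mult. replace (3 / 2 * (4 / 3)) with (1 + 1) by lra.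
    rewrite Rpower_plus, Rpower_1 by assumption. symmetry. apply HRsq. lra. }
  rewrite EI, Rpower_mult_distr by lra.
  apply Rle_Rpower_l; [lra|]. split; [|apply HP; lra].
  rewrite EP. apply exp_pos.
Qed.

(* I'^2 - 2 c ln I is nonincreasing, which prevents ln I from tending to -oo. *)
Lemma not_second_derive_ge_inv (I I1 I2 : R -> R) t1 T c :
  t1 < T -> 0 < c ->
  (forall t, t1 < t < T -> is_derive I t (I1 t)) ->
  (forall t, t1 < t < T -> is_derive I1 t (I2 t)) ->
  (forall t, t1 < t < T -> 0 < I t) ->
  (forall t, t1 < t < T -> I1 t <= 0) ->
  (forall t, t1 < t < T -> c / I t <= I2 t) ->
  ~ filterlim I (at_left T) (locally 0).
Proof.
  intros HT Hc HI HI1 Hpos Hneg HI2 Hlim.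
  set (t2 := (t1 + T) / 2). assert (Ht2 : t1 < t2 < T) by (unfold t2; lra).
  set (F := fun t => I1 t ^ 2 - 2 * c * ln (I t)).
  assert (HF : forall t, t2 <= t < T -> F t <= F t2).
  { intros t Ht.
    apply (nonincreasing_of_derive F (fun t => 2 * (I1 t * (I2 t - c / I t)))); [lra| |].
    - intros s Hs. pose proof (Hpos s ltac:(lra)) as HIs. unfold F.
      apply (is_derive_ext (fun s => I1 s * I1 s - 2 * c * ln (I s))).
      { intros r. change (I1 r * I1 r - 2 * c * ln (I r) = I1 r ^ 2 - 2 * c * ln (I r)). ring. }
      eapply is_derive_eq.
      + apply (is_derive_minus (fun s => I1 s * I1 s) (fun s => 2 * c * ln (I s))).
        * apply is_derive_Rmult; apply HI1; lra.
        * apply is_derive_scal. apply (is_derive_comp ln I).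
          -- now apply is_derive_ln.
          -- apply HI; lra.
      + change (I2 s * I1 s + I1 s * I2 s - 2 * c * (I1 s * / I s) = 2 * (I1 s * (I2 s - c / I s))).
        field. lra.
    - intros s Hs. pose proof (HI2 s ltac:(lra)). pose proof (Hneg s ltac:(lra)).
      assert (0 <= (- I1 s) * (I2 s - c / I s)) by (apply Rmult_le_pos; lra). lra. }
  (* Once [I s < e], the term [- 2 * c * ln (I s)] alone exceeds [F t2], against the monotonicity of
     [F]. *)
  set (e := exp (- (F t2 / (2 * c)))).
  assert (He : 0 < e) by apply exp_pos.
  destruct (at_left_ex T t2 _ ltac:(lra) (at_left_lim_lt _ _ _ _ Hlim He)) as (s & Hs & HIs).
  rewrite Rminus_0_r in HIs. pose proof (Hpos s ltac:(lra)).
  rewrite Rabs_pos_eq in HIs by lra.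
  apply ln_increasing in HIs; [|assumption]. unfold e in HIs. rewrite ln_exp in HIs.
  pose proof (HF s ltac:(lra)) as H1. unfold F at 1 in H1.
  pose proof (pow2_ge_0 (I1 s)).
  assert (2 * c * ln (I s) < 2 * c * - (F t2 / (2 * c))) by (apply Rmult_lt_compat_l; lra).
  replace (2 * c * - (F t2 / (2 * c))) with (- F t2) in H2 by (field; lra). lra.
Qed.

Lemma is_derive_Rpower_sub (T a t : R) : t < T ->
  is_derive (fun s => Rpower (T - s) a) t (- (a * Rpower (T - t) (a - 1))).
Proof.
  intros Ht.
  eapply is_derive_eq.
  - apply (is_derive_comp (fun x => Rpower x a) (fun s => T - s)).
    + apply is_derive_Reals, derivable_pt_lim_power. lra.
    + apply (is_derive_minus (fun _ => T) (fun s => s) t 0 1).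
      * apply (is_derive_const T).
      * apply (is_derive_id t).
  - change ((0 - 1) * (a * Rpower (T - t) (a - 1)) = - (a * Rpower (T - t) (a - 1))). ring.
Qed.

(** The function [f t - C / a * Rpower (T - t) a] is nondecreasing, so a positive excess at one time
    would persist up to [T]. The last hypothesis, which excludes this, stands in for a limit of [f]
    at [T]. *)
Lemma le_Rpower_of_derive_ge (f f1 : R -> R) t1 T C a :
  0 < a ->
  (forall t, t1 < t < T -> is_derive f t (f1 t)) ->
  (forall t, t1 < t < T -> - (C * Rpower (T - t) (a - 1)) <= f1 t) ->
  0 <= C ->
  (forall e t, 0 < e -> t1 < t < T -> ~ (forall s, t <= s < T -> e <= f s)) ->
  forall t, t1 < t < T -> f t <= C / a * Rpower (T - t) a.
Proof.
  intros Ha Hf Hf1 HC Hno t Ht. apply Rnot_lt_le. intros Hlt.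
  apply (Hno (f t - C / a * Rpower (T - t) a) t); [lra|assumption|].
  intros s Hs.
  assert (f t - C / a * Rpower (T - t) a <= f s - C / a * Rpower (T - s) a).
  { apply (nondecreasing_of_derive (fun s => f s - C / a * Rpower (T - s) a)
             (fun s => f1 s - C / a * (- (a * Rpower (T - s) (a - 1))))); [lra| |].
    - intros r Hr. apply (is_derive_minus f (fun s => C / a * Rpower (T - s) a)).
      + apply Hf; lra.
      + apply is_derive_scal, is_derive_Rpower_sub. lra.
    - intros r Hr. pose proof (Hf1 r ltac:(lra)).
      replace (C / a * (- (a * Rpower (T - r) (a - 1))))
        with (- (C * Rpower (T - r) (a - 1))) by (field; lra). lra. }
  assert (0 <= C / a * Rpower (T - s) a).
  { apply Rmult_le_pos; [apply Rdiv_le_0_compat; lra|left; apply exp_pos]. }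
  lra.
Qed.

(** * Algebra of the n-body equations *)

(** The mass inner product on configurations: moment of inertia, twice the kinetic energy, power and
    virial are all values of it. *)
Definition wdot (d n : nat) (g : nat -> R) (z y : nat -> nat -> R) : R :=
  rsum n (fun i => g i * rsum d (fun k => z i k * y i k)).

(** Zero mass outside the cluster turns cluster sums into sums over all bodies; with [G] constantly
    [true] the same formulas describe the whole system. *)
Definition gmass (m : nat -> R) (G : nat -> bool) (i : nat) : R := if G i then m i else 0.

(** The diagonal value 0 removes self-interaction, so double sums may run over all index pairs. The
    exponent is 1 for the potential and 3 for the force. *)
Definition kernel (d p : nat) (x : nat -> nat -> R) (i j : nat) : R :=
  if Nat.eqb j i then 0 else / vnorm d (fun l => x i l - x j l) ^ p.

(** The factor 1/2 compensates for counting ordered pairs. *)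
Definition pot (d n : nat) (g : nat -> R) (x : nat -> nat -> R) : R :=
  / 2 * rsum n (fun i => rsum n (fun j => g i * g j * kernel d 1 x i j)).

Definition ext_acc (d n : nat) (m : nat -> R) (G : nat -> bool) (x : nat -> nat -> R)
  (i k : nat) : R :=
  rsum n (fun j => gmass m (fun j => negb (G j)) j * kernel d 3 x i j * (x j k - x i k)).

Definition rel (n : nat) (m : nat -> R) (G : nat -> bool) (x : nat -> nat -> R)
  (i k : nat) : R := x i k - ccenter n m G x k.

(** The angular momentum component in the coordinate plane [(a, b)], which treats both dimensions
    uniformly; with an acceleration as [y] it is a torque. *)
Definition planar_momentum (n : nat) (g : nat -> R) (a b : nat) (z y : nat -> nat -> R) : R :=
  rsum n (fun i => g i * (z i a * y i b - z i b * y i a)).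

Lemma kernel_sym d p x i j : kernel d p x i j = kernel d p x j i.
Proof.
  unfold kernel. rewrite Nat.eqb_sym. destruct (Nat.eqb i j); [reflexivity|].
  now rewrite vnorm_sub_comm.
Qed.

Lemma gmass_nonneg n m G i :
  (forall i, (i < n)%nat -> 0 < m i) -> (i < n)%nat -> 0 <= gmass m G i.
Proof.
  intros Hm Hi. unfold gmass. destruct (G i); [|lra]. left; auto.
Qed.

Lemma wdot_ext d n g z z' y y' :
  (forall i k, (i < n)%nat -> (k < d)%nat -> z i k = z' i k) ->
  (forall i k, (i < n)%nat -> (k < d)%nat -> y i k = y' i k) ->
  wdot d n g z y = wdot d n g z' y'.
Proof.
  intros Hz Hy. apply rsum_ext; intros i Hi. f_equal. apply rsum_ext; intros k Hk.
  now rewrite Hz, Hy.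
Qed.

Lemma wdot_comm d n g z y : wdot d n g z y = wdot d n g y z.
Proof.
  apply rsum_ext; intros i _. f_equal. apply rsum_ext; intros k _. ring.
Qed.

Lemma wdot_plus_r d n g z y y' :
  wdot d n g z (fun i k => y i k + y' i k) = wdot d n g z y + wdot d n g z y'.
Proof.
  unfold wdot. rewrite <- rsum_plus. apply rsum_ext; intros i _.
  rewrite <- Rmult_plus_distr_l, <- rsum_plus. f_equal.
  apply rsum_ext; intros k _. ring.
Qed.

Lemma wdot_minus_r d n g z y y' :
  wdot d n g z (fun i k => y i k - y' i k) = wdot d n g z y - wdot d n g z y'.
Proof.
  unfold wdot. rewrite <- rsum_minus. apply rsum_ext; intros i _.
  rewrite <- Rmult_minus_distr_l, <- rsum_minus. f_equal.
  apply rsum_ext; intros k _. ring.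
Qed.

Lemma rsum_sqr_nonneg d (z : nat -> R) : 0 <= rsum d (fun k => z k * z k).
Proof. apply rsum_nonneg. intros k _. nra. Qed.

Lemma wdot_nonneg d n g z :
  (forall i, (i < n)%nat -> 0 <= g i) -> 0 <= wdot d n g z z.
Proof.
  intros Hg. apply rsum_nonneg; intros i Hi.
  apply Rmult_le_pos; [auto|apply rsum_sqr_nonneg].
Qed.

Lemma wdot_term_le d n g z i k :
  (forall i, (i < n)%nat -> 0 <= g i) -> (i < n)%nat -> (k < d)%nat ->
  g i * (z i k * z i k) <= wdot d n g z z.
Proof.
  intros Hg Hi Hk.
  apply Rle_trans with (g i * rsum d (fun k => z i k * z i k)).
  - apply Rmult_le_compat_l; [auto|].
    apply (rsum_term_le d (fun k => z i k * z i k)); [assumption|]. intros j _. nra.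
  - apply (rsum_term_le n (fun i => g i * rsum d (fun k => z i k * z i k))); [assumption|].
    intros j Hj. apply Rmult_le_pos; [auto|apply rsum_sqr_nonneg].
Qed.

Lemma dot_cauchy_schwarz d (z y : nat -> R) :
  rsum d (fun k => z k * y k) ^ 2
    <= rsum d (fun k => z k * z k) * rsum d (fun k => y k * y k).
Proof.
  pose proof (weighted_cauchy_schwarz d (fun _ => 1) (fun k => z k * z k)
                (fun k => y k * y k) (fun k => z k * y k)) as H.
  cbv beta in H. rewrite !rsum_scal, !Rmult_1_l in H.
  apply H; intros; nra.
Qed.

Lemma wdot_cauchy_schwarz d n g z y :
  (forall i, (i < n)%nat -> 0 <= g i) ->
  wdot d n g z y ^ 2 <= wdot d n g z z * wdot d n g y y.
Proof.
  intros Hg. unfold wdot.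
  apply (weighted_cauchy_schwarz n g (fun i => rsum d (fun k => z i k * z i k))
           (fun i => rsum d (fun k => y i k * y i k))
           (fun i => rsum d (fun k => z i k * y i k))); auto using rsum_sqr_nonneg.
  intros i _. apply dot_cauchy_schwarz.
Qed.

(** With relative positions and velocities this is Sundman's bound of the squared angular momentum
    by the inertia times twice the kinetic energy. *)
Lemma planar_momentum_sqr_le d n g a b z y :
  (forall i, (i < n)%nat -> 0 <= g i) -> (a < b)%nat -> (b < d)%nat ->
  planar_momentum n g a b z y ^ 2 <= wdot d n g z z * wdot d n g y y.
Proof.
  intros Hg Hab Hb.
  apply (weighted_cauchy_schwarz n g (fun i => rsum d (fun k => z i k * z i k))
           (fun i => rsum d (fun k => y i k * y i k))
           (fun i => z i a * y i b - z i b * y i a)); auto using rsum_sqr_nonneg.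
  intros i _.
  assert (H : forall u : nat -> R, u a * u a + u b * u b <= rsum d (fun k => u k * u k)).
  { intros u. clear - Hab Hb. revert a b Hab Hb.
    induction d as [|d IH]; intros a b Hab Hb; [lia|]. simpl.
    destruct (Nat.eq_dec b d) as [->|Hbd].
    - apply Rplus_le_compat_r.
      apply (rsum_term_le d (fun k => u k * u k) a Hab). intros; nra.
    - pose proof (IH a b Hab ltac:(lia)). nra. }
  (* Lagrange's identity in the plane: squared minor plus squared inner product equals the product
     of the squared norms. *)
  apply Rle_trans with ((z i a * z i a + z i b * z i b) * (y i a * y i a + y i b * y i b)).
  - pose proof (pow2_ge_0 (z i a * y i a + z i b * y i b)). nra.
  - apply Rmult_le_compat; auto; nra.
Qed.

Lemma is_derive_wdot d n g (Z Y : R -> nat -> nat -> R) (dz dy : nat -> nat -> R) (t : R) :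
  (forall i k, (i < n)%nat -> (k < d)%nat -> is_derive (fun s => Z s i k) t (dz i k)) ->
  (forall i k, (i < n)%nat -> (k < d)%nat -> is_derive (fun s => Y s i k) t (dy i k)) ->
  is_derive (fun s => wdot d n g (Z s) (Y s)) t (wdot d n g dz (Y t) + wdot d n g (Z t) dy).
Proof.
  intros HZ HY. unfold wdot. rewrite <- rsum_plus.
  apply (is_derive_rsum n (fun i s => g i * rsum d (fun k => Z s i k * Y s i k))).
  intros i Hi. rewrite <- Rmult_plus_distr_l, <- rsum_plus. apply is_derive_scal.
  apply (is_derive_rsum d (fun k s => Z s i k * Y s i k)).
  intros k Hk. apply (is_derive_Rmult (fun s => Z s i k) (fun s => Y s i k)); auto.
Qed.

Lemma is_derive_planar_momentum d n g a b (Z Y : R -> nat -> nat -> R)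
    (dz dy : nat -> nat -> R) (t : R) :
  (a < d)%nat -> (b < d)%nat ->
  (forall i k, (i < n)%nat -> (k < d)%nat -> is_derive (fun s => Z s i k) t (dz i k)) ->
  (forall i k, (i < n)%nat -> (k < d)%nat -> is_derive (fun s => Y s i k) t (dy i k)) ->
  is_derive (fun s => planar_momentum n g a b (Z s) (Y s)) t
    (planar_momentum n g a b dz (Y t) + planar_momentum n g a b (Z t) dy).
Proof.
  intros Ha Hb HZ HY. unfold planar_momentum. rewrite <- rsum_plus.
  apply (is_derive_rsum n (fun i s => g i * (Z s i a * Y s i b - Z s i b * Y s i a))).
  intros i Hi. rewrite <- Rmult_plus_distr_l. apply is_derive_scal.
  eapply is_derive_eq.
  - apply (is_derive_minus (fun s => Z s i a * Y s i b) (fun s => Z s i b * Y s i a));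
      apply (is_derive_Rmult (fun s => Z s i _) (fun s => Y s i _)); auto.
  - match goal with |- minus ?u ?v = ?w => change (u - v = w) end. ring.
Qed.

Lemma newton_acc_split d n m G x i k :
  newton_acc d n m x i k
  = rsum n (fun j => gmass m G j * kernel d 3 x i j * (x j k - x i k)) + ext_acc d n m G x i k.
Proof.
  unfold newton_acc, ext_acc. rewrite <- rsum_plus. apply rsum_ext; intros j _.
  unfold gmass, kernel, Rdiv. destruct (Nat.eqb j i), (G j); simpl; ring.
Qed.

(** By action and reaction the internal forces see only the differences of [z]. The choice of [z] is
    free: velocities give the power, positions the virial, and the limits [L] an error term. *)
Lemma wdot_newton_acc d n m G z x :
  wdot d n (gmass m G) z (newton_acc d n m x)
  = - / 2 * rsum n (fun i => rsum n (fun j => gmass m G i * gmass m G j * kernel d 3 x i j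
        * rsum d (fun k => (z i k - z j k) * (x i k - x j k))))
    + wdot d n (gmass m G) z (ext_acc d n m G x).
Proof.
  set (g := gmass m G).
  rewrite (wdot_ext d n g z z _ (fun i k =>
     rsum n (fun j => g j * kernel d 3 x i j * (x j k - x i k)) + ext_acc d n m G x i k));
    [|reflexivity|intros; apply newton_acc_split].
  rewrite wdot_plus_r. f_equal. unfold wdot.
  transitivity (rsum d (fun k => rsum n (fun i => rsum n (fun j =>
      g i * g j * kernel d 3 x i j * (z i k * (x j k - x i k)))))).
  - rewrite rsum_swap. apply rsum_ext; intros i _. rewrite <- rsum_scal.
    apply rsum_ext; intros k _. rewrite <- !rsum_scal.
    apply rsum_ext; intros j _. ring.
  - transitivity (rsum d (fun k => - / 2 * rsum n (fun i => rsum n (fun j =>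
      g i * g j * kernel d 3 x i j * ((z i k - z j k) * (x i k - x j k)))))).
    + apply rsum_ext; intros k _.
      apply (rsum_antisym n (fun i j => g i * g j * kernel d 3 x i j)
               (fun i => z i k) (fun i => x i k)).
      intros i j. rewrite kernel_sym. ring.
    + rewrite rsum_scal. f_equal. rewrite rsum_swap. apply rsum_ext; intros i _.
      rewrite rsum_swap. apply rsum_ext; intros j _. now rewrite rsum_scal.
Qed.

(** Internal torques cancel because each internal force points along the line joining its two
    bodies. *)
Lemma planar_momentum_newton_acc d n m G a b z x :
  (forall i j k, z i k - z j k = x i k - x j k) ->
  planar_momentum n (gmass m G) a b z (newton_acc d n m x)
  = planar_momentum n (gmass m G) a b z (ext_acc d n m G x).
Proof.
  intros Hz. set (g := gmass m G). unfold planar_momentum.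
  transitivity (rsum n (fun i => rsum n (fun j =>
      g i * g j * kernel d 3 x i j * (z i a * (x j b - x i b))))
    - rsum n (fun i => rsum n (fun j =>
      g i * g j * kernel d 3 x i j * (z i b * (x j a - x i a))))
    + rsum n (fun i => g i * (z i a * ext_acc d n m G x i b - z i b * ext_acc d n m G x i a))).
  - rewrite <- rsum_minus, <- rsum_plus. apply rsum_ext; intros i _.
    rewrite !(newton_acc_split d n m G). fold g.
    transitivity (rsum n (fun j => z i a * g i * (g j * kernel d 3 x i j * (x j b - x i b)))
      - rsum n (fun j => z i b * g i * (g j * kernel d 3 x i j * (x j a - x i a)))
      + g i * (z i a * ext_acc d n m G x i b - z i b * ext_acc d n m G x i a)).
    + rewrite !rsum_scal. ring.
    + f_equal. f_equal; apply rsum_ext; intros j _; ring.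
  - assert (Hsym : forall i j, g i * g j * kernel d 3 x i j = g j * g i * kernel d 3 x j i)
      by (intros i j; rewrite kernel_sym; ring).
    rewrite (rsum_antisym n (fun i j => g i * g j * kernel d 3 x i j)
               (fun i => z i a) (fun i => x i b) Hsym).
    rewrite (rsum_antisym n (fun i j => g i * g j * kernel d 3 x i j)
               (fun i => z i b) (fun i => x i a) Hsym).
    (* After symmetrization both sums contain the product of the [a] and [b] differences, which is
       symmetric in [a] and [b]. *)
    match goal with |- _ * ?A - _ * ?B + ?C = _ => assert (E : A = B) end.
    { apply rsum_ext; intros i _. apply rsum_ext; intros j _. rewrite !Hz. ring. }
    rewrite E. ring.
Qed.

Lemma kernel_sqr d n x i j :
  (forall i j, (i < n)%nat -> (j < n)%nat -> i <> j -> 0 < vnorm d (fun l => x i l - x j l)) ->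
  (i < n)%nat -> (j < n)%nat ->
  kernel d 3 x i j * rsum d (fun k => (x i k - x j k) * (x i k - x j k)) = kernel d 1 x i j.
Proof.
  intros Hpos Hi Hj. unfold kernel. destruct (Nat.eqb_spec j i); [ring|].
  rewrite (rsum_ext d _ (fun k => (x i k - x j k) ^ 2)) by (intros; ring).
  rewrite <- (vnorm_sqr d (fun k => x i k - x j k)).
  pose proof (Hpos i j Hi Hj ltac:(auto)). field. lra.
Qed.

(** Euler's relation for a potential homogeneous of degree -1. Allowing any translate [z] of [x]
    covers positions relative to the center of mass. *)
Lemma wdot_newton_acc_virial d n m G z x :
  (forall i j, (i < n)%nat -> (j < n)%nat -> i <> j -> 0 < vnorm d (fun l => x i l - x j l)) ->
  (forall i j k, z i k - z j k = x i k - x j k) ->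
  wdot d n (gmass m G) z (newton_acc d n m x)
  = - pot d n (gmass m G) x + wdot d n (gmass m G) z (ext_acc d n m G x).
Proof.
  intros Hpos Hz. rewrite wdot_newton_acc. f_equal. unfold pot.
  rewrite Ropp_mult_distr_l. f_equal.
  apply rsum_ext; intros i Hi. apply rsum_ext; intros j Hj.
  rewrite <- (kernel_sqr d n) by assumption. rewrite <- Rmult_assoc. f_equal.
  apply rsum_ext; intros k _. now rewrite Hz.
Qed.

(** The cluster potential changes at the rate of the power of the internal forces, written here as
    total power minus external power. *)
Lemma is_derive_pot d n m G (X : R -> nat -> nat -> R) (v : nat -> nat -> R) (t : R) :
  (forall i k, (i < n)%nat -> (k < d)%nat -> is_derive (fun s => X s i k) t (v i k)) ->
  (forall i j, (i < n)%nat -> (j < n)%nat -> i <> j ->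
     0 < vnorm d (fun l => X t i l - X t j l)) ->
  is_derive (fun s => pot d n (gmass m G) (X s)) t
    (wdot d n (gmass m G) v (newton_acc d n m (X t))
     - wdot d n (gmass m G) v (ext_acc d n m G (X t))).
Proof.
  intros HX Hpos. rewrite wdot_newton_acc. set (g := gmass m G).
  eapply is_derive_eq.
  - unfold pot. apply is_derive_scal.
    apply (is_derive_rsum n (fun i s => rsum n (fun j => g i * g j * kernel d 1 (X s) i j))
      (fun i => rsum n (fun j => g i * g j * (- (kernel d 3 (X t) i j
         * rsum d (fun k => (v i k - v j k) * (X t i k - X t j k))))))).
    intros i Hi.
    apply (is_derive_rsum n (fun j s => g i * g j * kernel d 1 (X s) i j)).
    intros j Hj. apply is_derive_scal. unfold kernel.
    destruct (Nat.eqb_spec j i) as [->|Hij].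
    + eapply is_derive_eq; [apply is_derive_const|]. change (0 = - (0 * rsum d (fun k => (v i k - v i k) * (X t i k - X t i k)))). ring.
    + apply (is_derive_ext (fun s => / vnorm d (fun l => X s i l - X s j l))).
      { intros s. f_equal. change (vnorm d (fun l => X s i l - X s j l) = vnorm d (fun l => X s i l - X s j l) ^ 1). ring. }
      eapply is_derive_eq.
      * apply (is_derive_inv_vnorm d (fun l s => X s i l - X s j l) (fun l => v i l - v j l)).
        -- intros k Hk. apply (is_derive_minus (fun s => X s i k) (fun s => X s j k)); auto.
        -- apply Hpos; auto.
      * cbv beta. pose proof (Hpos i j Hi Hj ltac:(auto)).
        rewrite (rsum_ext d (fun k => (v i k - v j k) * (X t i k - X t j k))
                   (fun k => (X t i k - X t j k) * (v i k - v j k))) by (intros; ring).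
        field. lra.
  - unfold g. rewrite <- Rplus_minus_assoc, Rminus_diag, Rplus_0_r.
    rewrite <- Ropp_mult_distr_l, Ropp_mult_distr_r. f_equal.
    match goal with |- _ = - ?A => replace (- A) with (-1 * A) by ring end.
    rewrite <- rsum_scal. apply rsum_ext; intros i _.
    rewrite <- rsum_scal. apply rsum_ext; intros j _. ring.
Qed.

(** * Reduction to the center of mass *)

Lemma cmass_gmass n m G : cmass n m G = rsum n (gmass m G).
Proof. reflexivity. Qed.

Lemma ccenter_gmass n m G y k :
  ccenter n m G y k = rsum n (fun i => gmass m G i * y i k) / cmass n m G.
Proof.
  unfold ccenter. f_equal. apply rsum_ext; intros i _. unfold gmass.
  destruct (G i); ring.
Qed.

Lemma rsum_gmass_rel n m G x k : cmass n m G <> 0 ->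
  rsum n (fun i => gmass m G i * rel n m G x i k) = 0.
Proof.
  intros H. unfold rel.
  rewrite (rsum_ext n _ (fun i => gmass m G i * x i k - gmass m G i * ccenter n m G x k))
    by (intros; ring).
  rewrite rsum_minus, rsum_scal_r, <- cmass_gmass, ccenter_gmass. now field.
Qed.

Lemma wdot_rel_const d n m G x (e : nat -> R) : cmass n m G <> 0 ->
  wdot d n (gmass m G) (rel n m G x) (fun _ k => e k) = 0.
Proof.
  intros H. unfold wdot.
  transitivity (rsum d (fun k => rsum n (fun i => gmass m G i * rel n m G x i k) * e k)).
  - rewrite (rsum_ext d _ (fun k => rsum n (fun i => gmass m G i * rel n m G x i k * e k)))
      by (intros; now rewrite rsum_scal_r).
    rewrite rsum_swap. apply rsum_ext; intros i _. rewrite <- rsum_scal.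
    apply rsum_ext; intros; ring.
  - rewrite <- (rsum_zero d). apply rsum_ext; intros k _. rewrite rsum_gmass_rel by assumption. ring.
Qed.

Lemma wdot_rel_rel d n m G x y : cmass n m G <> 0 ->
  wdot d n (gmass m G) (rel n m G x) (rel n m G y) = wdot d n (gmass m G) (rel n m G x) y.
Proof.
  intros H. unfold rel at 2. rewrite wdot_minus_r, wdot_rel_const by assumption. ring.
Qed.

(** The mass-weighted relative positions sum to zero, so a vector common to all bodies exerts no
    torque. This removes the acceleration of the center and, later, the external acceleration of a
    reference body. *)
Lemma planar_momentum_rel_shift n m G a b x y (e : nat -> R) : cmass n m G <> 0 ->
  planar_momentum n (gmass m G) a b (rel n m G x) (fun i k => y i k - e k)
  = planar_momentum n (gmass m G) a b (rel n m G x) y.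
Proof.
  intros H. unfold planar_momentum.
  rewrite (rsum_ext n _ (fun i =>
      gmass m G i * (rel n m G x i a * y i b - rel n m G x i b * y i a)
      - (gmass m G i * rel n m G x i a * e b - gmass m G i * rel n m G x i b * e a)))
    by (intros; ring).
  rewrite !rsum_minus, !rsum_scal_r, !rsum_gmass_rel by assumption. ring.
Qed.

Lemma planar_momentum_self n g a b z : planar_momentum n g a b z z = 0.
Proof.
  unfold planar_momentum. rewrite <- (rsum_zero n). apply rsum_ext; intros; ring.
Qed.

Lemma is_derive_rel n m G (X : R -> nat -> nat -> R) (v : nat -> nat -> R) (t : R) i k :
  (forall i, (i < n)%nat -> is_derive (fun s => X s i k) t (v i k)) -> (i < n)%nat ->
  is_derive (fun s => rel n m G (X s) i k) t (rel n m G v i k).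
Proof.
  intros HX Hi. unfold rel.
  apply (is_derive_minus (fun s => X s i k) (fun s => ccenter n m G (X s) k)); [auto|].
  rewrite ccenter_gmass. unfold Rdiv. rewrite Rmult_comm.
  apply (is_derive_ext (fun s => / cmass n m G * rsum n (fun i => gmass m G i * X s i k))).
  { intros s. rewrite ccenter_gmass. apply Rmult_comm. }
  apply is_derive_scal.
  apply (is_derive_rsum n (fun i s => gmass m G i * X s i k)).
  intros j Hj. apply is_derive_scal. auto.
Qed.

(** The middle component in dimension 3 lists its indices in decreasing order, whence the sign [s].
    As [a], [b] and [s] are chosen before [x] and [v], the identity can be differentiated in
    time. *)
Lemma mu0_planar_momentum d n m G k : d = 2%nat \/ d = 3%nat -> (k < ncross d)%nat ->
  exists a b s, (a < b)%nat /\ (b < d)%nat /\ Rabs s = 1 /\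
    forall x v, mu0 d n m G x v k
      = s * planar_momentum n (gmass m G) a b (rel n m G x) (rel n m G v).
Proof.
  intros Hd Hk.
  assert (E : forall a b s, (forall u w, cross d u w k = s * (u a * w b - u b * w a)) ->
    forall x v, mu0 d n m G x v k
      = s * planar_momentum n (gmass m G) a b (rel n m G x) (rel n m G v)).
  { intros a b s H x v. unfold mu0, planar_momentum. rewrite <- rsum_scal.
    apply rsum_ext; intros i _. rewrite H. unfold gmass. destruct (G i); unfold rel; ring. }
  destruct Hd as [->| ->]; simpl in Hk.
  - exists 0%nat, 1%nat, 1. repeat split; try lia; [apply Rabs_R1|].
    apply E. intros u w. assert (k = 0)%nat as -> by lia. simpl. ring.
  - assert (k = 0 \/ k = 1 \/ k = 2)%nat as [->|[->| ->]] by lia.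
    + exists 1%nat, 2%nat, 1. repeat split; try lia; [apply Rabs_R1|].
      apply E. intros u w. simpl. ring.
    + exists 0%nat, 2%nat, (-1). repeat split; try lia; [rewrite Rabs_left; lra|].
      apply E. intros u w. simpl. ring.
    + exists 0%nat, 1%nat, 1. repeat split; try lia; [apply Rabs_R1|].
      apply E. intros u w. simpl. ring.
Qed.

Lemma big_o_gmass T m G i (f h : R -> R) :
  (G i = true -> big_o T f h) -> big_o T (fun t => gmass m G i * f t) h.
Proof.
  intros H. unfold gmass. destruct (G i).
  - now apply big_o_scal, H.
  - apply big_o_ext with (fun _ => 0); [intros; ring|apply big_o_zero].
Qed.

Lemma big_o_wdot T d n m G (Z Y : R -> nat -> nat -> R) (h k : R -> R) :
  (forall i l, G i = true -> (i < n)%nat -> (l < d)%nat -> big_o T (fun t => Z t i l) h) ->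
  (forall i l, G i = true -> (i < n)%nat -> (l < d)%nat -> big_o T (fun t => Y t i l) k) ->
  big_o T (fun t => wdot d n (gmass m G) (Z t) (Y t)) (fun t => h t * k t).
Proof.
  intros HZ HY. apply big_o_rsum; intros i Hi. apply big_o_gmass; intros Gi.
  apply big_o_rsum; intros l Hl. apply big_o_mult; auto.
Qed.

(** Passing to relative vectors is an orthogonal projection for the cluster inner product, hence
    shrinks the norm; enlarging the cluster to all bodies only adds nonnegative terms. *)
Lemma wdot_rel_le d n m G y :
  (forall i, (i < n)%nat -> 0 < m i) -> cmass n m G <> 0 ->
  wdot d n (gmass m G) (rel n m G y) (rel n m G y)
    <= wdot d n (gmass m (fun _ => true)) y y.
Proof.
  intros Hm HM.
  assert (Hg : forall i, (i < n)%nat -> 0 <= gmass m G i) by (intros; eapply gmass_nonneg; eauto).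
  apply Rle_trans with (wdot d n (gmass m G) y y).
  - pose proof (wdot_cauchy_schwarz d n _ (rel n m G y) y Hg) as H.
    pose proof (wdot_rel_rel d n m G y y HM) as E. rewrite <- E in H.
    pose proof (wdot_nonneg d n _ (rel n m G y) Hg).
    pose proof (wdot_nonneg d n _ y Hg). nra.
  - apply rsum_le; intros i Hi. apply Rmult_le_compat_r; [apply rsum_sqr_nonneg|].
    unfold gmass. destruct (G i); [lra|]. left; auto.
Qed.

Lemma wdot_Rabs_le d n g z y :
  (forall i, (i < n)%nat -> 0 <= g i) ->
  Rabs (wdot d n g z y) <= wdot d n g z z + wdot d n g y y.
Proof.
  intros Hg. pose proof (wdot_cauchy_schwarz d n g z y Hg).
  pose proof (wdot_nonneg d n g z Hg). pose proof (wdot_nonneg d n g y Hg).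
  apply Rabs_le. split; nra.
Qed.

Lemma ext_acc_full d n m x i k : ext_acc d n m (fun _ => true) x i k = 0.
Proof.
  apply rsum_eq_zero; intros j _. unfold gmass. simpl. ring.
Qed.

Lemma wdot_zero_r d n g z y : (forall i k, y i k = 0) -> wdot d n g z y = 0.
Proof.
  intros Hy. apply rsum_eq_zero; intros i _.
  rewrite rsum_eq_zero; [ring|]. intros k _. rewrite Hy. ring.
Qed.

Lemma wdot_newton_acc_shift d n m G z z' x :
  (forall i j k, z i k - z j k = z' i k - z' j k) ->
  wdot d n (gmass m G) z (newton_acc d n m x) - wdot d n (gmass m G) z (ext_acc d n m G x)
  = wdot d n (gmass m G) z' (newton_acc d n m x) - wdot d n (gmass m G) z' (ext_acc d n m G x).
Proof.
  intros H. rewrite !wdot_newton_acc.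
  match goal with |- _ * ?A + _ - _ = _ * ?B + _ - _ => assert (E : A = B) end.
  { apply rsum_ext; intros i _. apply rsum_ext; intros j _. f_equal.
    apply rsum_ext; intros k _. now rewrite H. }
  rewrite E. ring.
Qed.

(** The difference of inverses is [(b * b - a * a)] over [a * b * (a + b)]; dropping [a] from the
    sum enlarges it. Squares appear because a squared norm is a polynomial in the coordinates. *)
Lemma inv_sub_le a b : 0 < a -> 0 < b ->
  Rabs (/ a - / b) <= Rabs ((b * b - a * a) * (/ a * (/ b * / b))).
Proof.
  intros Ha Hb.
  replace (/ a - / b) with ((b * b - a * a) * (/ a * / b) * / (a + b)) by (field; lra).
  replace ((b * b - a * a) * (/ a * (/ b * / b)))
    with ((b * b - a * a) * (/ a * / b) * / b) by ring.
  rewrite !(Rabs_mult _ (/ _)).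
  assert (0 < / (a + b)) by (apply Rinv_0_lt_compat; lra).
  assert (0 < / b) by (now apply Rinv_0_lt_compat).
  rewrite (Rabs_pos_eq (/ (a + b))), (Rabs_pos_eq (/ b)) by lra.
  apply Rmult_le_compat_l; [apply Rabs_pos|].
  apply Rinv_le_contravar; lra.
Qed.

(** As a product of first powers the force kernel can be compared at two bodies by
    [big_o_mult_diff]. *)
Lemma kernel_cube d x i j : kernel d 3 x i j
  = kernel d 1 x i j * (kernel d 1 x i j * kernel d 1 x i j).
Proof.
  unfold kernel. destruct (Nat.eqb j i); [ring|].
  rewrite <- !Rinv_mult. f_equal. ring.
Qed.

(** * Motion near the collision *)

Definition traj (q : nat -> R -> nat -> R) (t : R) (i k : nat) : R := q i t k.

Section Collision.

Variables (d n : nat) (m : nat -> R) (t0 T : R) (q v : nat -> R -> nat -> R) (L : nat -> nat -> R).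
Hypothesis Hm : forall i, (i < n)%nat -> 0 < m i.
Hypothesis HT : t0 < T.
Hypothesis Hqv : forall i k t, (i < n)%nat -> (k < d)%nat -> t0 < t < T ->
  is_derive (fun s => traj q s i k) t (traj v t i k).
Hypothesis Hvacc : forall i k t, (i < n)%nat -> (k < d)%nat -> t0 < t < T ->
  is_derive (fun s => traj v s i k) t (newton_acc d n m (traj q t) i k).
Hypothesis Hpos : forall t i j, t0 < t < T -> (i < n)%nat -> (j < n)%nat -> i <> j ->
  0 < vnorm d (fun k => traj q t i k - traj q t j k).
Hypothesis HL : forall i k, (i < n)%nat -> (k < d)%nat ->
  filterlim (fun t => traj q t i k) (at_left T) (locally (L i k)).

Lemma big_o_traj i k : (i < n)%nat -> (k < d)%nat -> big_o T (fun t => traj q t i k) (fun _ => 1).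
Proof. intros Hi Hk. eapply big_o_lim, HL; auto. Qed.

(** Near [T] the distance of the two bodies is at least half the gap between their limits in
    coordinate [k]. *)
Lemma big_o_kernel p i j k : (i < n)%nat -> (j < n)%nat -> (k < d)%nat -> L i k <> L j k ->
  big_o T (fun t => kernel d p (traj q t) i j) (fun _ => 1).
Proof.
  intros Hi Hj Hk HLij. unfold kernel. destruct (Nat.eqb_spec j i); [apply big_o_zero|].
  set (e := Rabs (L i k - L j k) / 2).
  assert (He : 0 < e) by (pose proof (Rabs_pos_lt (L i k - L j k) ltac:(lra)); unfold e; lra).
  pose proof (lim_minus T _ _ _ _ (HL i k Hi Hk) (HL j k Hj Hk)) as Hlim.
  exists (/ e ^ p). generalize (at_left_lim_lt _ _ _ _ Hlim He).
  apply filter_imp. intros t Ht.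
  pose proof (Rabs_le_vnorm d (fun l => traj q t i l - traj q t j l) k Hk) as HN.
  cbv beta in HN, Ht. set (N := vnorm d _) in *.
  assert (e <= N).
  { pose proof (Rabs_triang_inv (L i k - L j k) (traj q t i k - traj q t j k)) as H1.
    rewrite Rabs_minus_sym in Ht. unfold e in *. lra. }
  rewrite Rmult_1_r, Rabs_pos_eq.
  - apply Rinv_le_contravar; [now apply pow_lt|]. apply pow_incr. lra.
  - left. apply Rinv_0_lt_compat, pow_lt. lra.
Qed.

(** The cluster of all bodies has no external acceleration, so the derivatives of kinetic and
    potential energy are the same power. *)
Lemma energy_conserved : exists H, forall t, t0 < t < T ->
  / 2 * wdot d n (gmass m (fun _ => true)) (traj v t) (traj v t)
  - pot d n (gmass m (fun _ => true)) (traj q t) = H.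
Proof.
  set (G := fun _ : nat => true). set (g := gmass m G).
  set (F := fun t => / 2 * wdot d n g (traj v t) (traj v t) - pot d n g (traj q t)).
  assert (HF : forall t, t0 < t < T -> is_derive F t 0).
  { intros t Ht. eapply is_derive_eq.
    - apply (is_derive_minus (fun t => / 2 * wdot d n g (traj v t) (traj v t))
               (fun t => pot d n g (traj q t))).
      + apply is_derive_scal. apply (is_derive_wdot d n g (traj v) (traj v)
          (newton_acc d n m (traj q t)) (newton_acc d n m (traj q t)));
          intros; apply Hvacc; auto.
      + apply (is_derive_pot d n m G (traj q) (traj v t)); [intros; apply Hqv; auto|intros; apply Hpos; auto].
    - fold g. rewrite (wdot_zero_r d n g (traj v t) (ext_acc d n m G (traj q t)))
        by (intros; apply ext_acc_full).
      rewrite (wdot_comm d n g (newton_acc d n m (traj q t))).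
      match goal with |- minus ?a ?b = ?c => change (a - b = c) end. field. }
  exists (F ((t0 + T) / 2)). intros t Ht. fold (F t).
  assert (Hmon : forall a b, t0 < a -> a <= b -> b < T -> F a = F b).
  { intros a b Ha Hab Hb. apply Rle_antisym.
    - apply (nondecreasing_of_derive F (fun _ => 0)); auto; intros; [apply HF|]; lra.
    - apply (nonincreasing_of_derive F (fun _ => 0)); auto; intros; [apply HF|]; lra. }
  destruct (Rle_dec t ((t0 + T) / 2)).
  - apply Hmon; lra.
  - symmetry. apply Hmon; lra.
Qed.

(* Lagrange-Jacobi for sum m |q - L|^2, which tends to 0 even if only some bodies collide:
   its second derivative is twice the kinetic energy up to O(1). *)
Lemma kinetic_energy_dominated : exists (S1 S2 : R -> R) (C t1 : R),
  t0 <= t1 < T /\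
  (forall t, t1 < t < T -> is_derive S1 t (S2 t)) /\
  (forall t, t1 < t < T ->
     wdot d n (gmass m (fun _ => true)) (traj v t) (traj v t) <= S2 t + C) /\
  big_o T S1 (fun _ => 1).
Proof.
  set (G := fun _ : nat => true). set (g := gmass m G).
  assert (Hg : forall i, (i < n)%nat -> 0 <= g i) by (intros; eapply gmass_nonneg; eauto).
  destruct energy_conserved as [H HH]. fold G g in HH.
  set (Z := fun t i k => traj q t i k - L i k).
  set (S := fun t => wdot d n g (Z t) (Z t)).
  set (S1 := fun t => 2 * wdot d n g (Z t) (traj v t)).
  set (S2 := fun t => 2 * (wdot d n g (traj v t) (traj v t)
                           + wdot d n g (Z t) (newton_acc d n m (traj q t)))).
  assert (HZ : forall t i k, t0 < t < T -> (i < n)%nat -> (k < d)%nat ->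
    is_derive (fun s => Z s i k) t (traj v t i k)).
  { intros t i k Ht Hi Hk. unfold Z. eapply is_derive_eq.
    - apply (is_derive_minus (fun s => traj q s i k) (fun _ => L i k)); [now apply Hqv|].
      apply is_derive_const.
    - change (traj v t i k - 0 = traj v t i k). ring. }
  assert (HS : forall t, t0 < t < T -> is_derive S t (S1 t)).
  { intros t Ht. eapply is_derive_eq; [apply (is_derive_wdot d n g Z Z (traj v t) (traj v t)); intros; apply HZ; auto|].
    unfold S1. rewrite (wdot_comm d n g (traj v t)). ring. }
  assert (HS1 : forall t, t0 < t < T -> is_derive S1 t (S2 t)).
  { intros t Ht. apply is_derive_scal.
    apply (is_derive_wdot d n g Z (traj v) (traj v t) (newton_acc d n m (traj q t))); intros; [apply HZ|apply Hvacc]; auto. }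
  (* The price of measuring positions from [L]. It stays bounded: a pair with equal limits drops out
     coordinatewise, and for distinct limits the kernel is bounded. *)
  set (Y := fun t => wdot d n g L (newton_acc d n m (traj q t))).
  assert (HY : big_o T Y (fun _ => 1)).
  { unfold Y, g. eapply big_o_ext; [intros t; symmetry; apply wdot_newton_acc|].
    apply big_o_plus.
    - apply big_o_scal. apply big_o_rsum; intros i Hi. apply big_o_rsum; intros j Hj.
      apply big_o_ext with (fun t => rsum d (fun k => gmass m G i * gmass m G j * ((L i k - L j k)
        * (kernel d 3 (traj q t) i j * (traj q t i k - traj q t j k))))).
      { intros t. rewrite <- rsum_scal. apply rsum_ext; intros; ring. }
      apply big_o_rsum; intros k Hk. apply big_o_scal.
      destruct (Req_dec (L i k) (L j k)) as [E|E].
      + apply big_o_ext with (fun _ => 0); [intros; rewrite E; ring|apply big_o_zero].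
      + apply big_o_scal, big_o_mult_1l; [now apply big_o_kernel with k|].
        apply big_o_minus; now apply big_o_traj.
    - apply big_o_ext with (fun _ => 0); [|apply big_o_zero].
      intros t. symmetry. apply wdot_zero_r. intros; apply ext_acc_full. }
  (* The virial identity contributes minus twice the potential, which energy conservation trades for
     [2 * H] minus the squared velocity norm. *)
  assert (ES2 : forall t, t0 < t < T ->
    S2 t = wdot d n g (traj v t) (traj v t) + 2 * H - 2 * Y t).
  { intros t Ht. unfold S2, Y. rewrite <- (HH t Ht).
    rewrite (wdot_comm d n g (Z t)). unfold Z. rewrite wdot_minus_r.
    rewrite (wdot_comm d n g _ (traj q t)), (wdot_comm d n g _ L).
    unfold g at 2. rewrite wdot_newton_acc_virial;
      [|intros; apply Hpos; auto|reflexivity].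
    rewrite (wdot_zero_r d n _ (traj q t) (ext_acc d n m G (traj q t)))
      by (intros; apply ext_acc_full).
    fold g. field. }
  destruct HY as [CY HY]. apply at_left_iff in HY as (t2 & Ht2 & HY).
  set (C := 2 * Rabs H + 2 * Rabs CY). set (t1 := Rmax t0 t2).
  assert (Ht1 : t0 <= t1 < T /\ t2 <= t1).
  { unfold t1. pose proof (Rmax_l t0 t2). pose proof (Rmax_r t0 t2).
    pose proof (Rmax_lub_lt t0 t2 T HT Ht2). lra. }
  assert (HK : forall t, t1 < t < T -> wdot d n g (traj v t) (traj v t) <= S2 t + C).
  { intros t Ht. rewrite ES2 by lra. pose proof (HY t ltac:(lra)) as H1.
    rewrite Rmult_1_r in H1. apply Rabs_le_between in H1. unfold C.
    pose proof (Rle_abs CY). pose proof (Rcomplements.Rabs_maj2 H). lra. }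
  exists S1, S2, C, t1. split; [lra|]. split; [|split; [exact HK|]].
  - intros t Ht. apply HS1. lra.
  - apply (derive_bounded_of_lim_zero S S1 S2 t1 T C); try lra.
    + unfold C. pose proof (Rabs_pos H). pose proof (Rabs_pos CY). lra.
    + intros t Ht. apply HS. lra.
    + intros t Ht. apply HS1. lra.
    + intros t Ht. now apply wdot_nonneg.
    + intros t Ht. pose proof (HK t Ht). pose proof (wdot_nonneg d n g (traj v t) Hg). lra.
    + apply lim_eq with (rsum n (fun i => g i * rsum d (fun k => 0 * 0))).
      * apply (lim_rsum T n (fun i t => g i * rsum d (fun k => Z t i k * Z t i k))). intros i Hi.
        apply (lim_mult T (fun _ => g i) (fun t => rsum d (fun k => Z t i k * Z t i k)));
          [apply lim_const|].
        apply (lim_rsum T d (fun k t => Z t i k * Z t i k)). intros k Hk.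
        assert (HZlim : filterlim (fun t => Z t i k) (at_left T) (locally 0)).
        { apply lim_eq with (L i k - L i k); [|ring].
          apply (lim_minus T (fun t => traj q t i k) (fun _ => L i k)); [auto|apply lim_const]. }
        now apply lim_mult.
      * apply rsum_eq_zero; intros i _. rewrite rsum_eq_zero; [ring|]. intros; ring.
Qed.

(** * The cluster and its moment of inertia *)

Variable G : nat -> bool.
Hypothesis HGn : forall i, G i = true -> (i < n)%nat.
Hypothesis HGsame : forall i j k, G i = true -> G j = true -> (k < d)%nat -> L i k = L j k.
Hypothesis HGsep : forall i j, G i = true -> (j < n)%nat -> G j = false ->
  exists k, (k < d)%nat /\ L j k <> L i k.
Variables i0 j0 : nat.
Hypothesis Hi0 : G i0 = true.
Hypothesis Hj0 : G j0 = true.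
Hypothesis Hij0 : i0 <> j0.

Let g := gmass m G.
Let r (t : R) := rel n m G (traj q t).
Let w (t : R) := rel n m G (traj v t).
Let acc (t : R) := newton_acc d n m (traj q t).
Let ext (t : R) := ext_acc d n m G (traj q t).

Let inertia (t : R) : R := wdot d n g (r t) (r t).
Let inertia1 (t : R) : R := 2 * wdot d n g (r t) (w t).
(** The absolute acceleration may stand here, since the acceleration of the center is orthogonal to
    [r t]. *)
Let inertia2 (t : R) : R := 2 * (wdot d n g (w t) (w t) + wdot d n g (r t) (acc t)).

Lemma cluster_mass_nonneg i : (i < n)%nat -> 0 <= g i.
Proof. intros; eapply gmass_nonneg; eauto. Qed.

Lemma cluster_mass_pos i : G i = true -> 0 < g i.
Proof. intros Gi. unfold g, gmass. rewrite Gi. auto. Qed.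

Lemma cluster_total_mass_pos : 0 < cmass n m G.
Proof.
  apply Rlt_le_trans with (g i0); [now apply cluster_mass_pos|].
  rewrite cmass_gmass. apply (rsum_term_le n (gmass m G)); auto using cluster_mass_nonneg.
Qed.

Lemma is_derive_rel_traj t i k : t0 < t < T -> (i < n)%nat -> (k < d)%nat ->
  is_derive (fun s => r s i k) t (w t i k).
Proof. intros Ht Hi Hk. apply is_derive_rel; auto. Qed.

Lemma is_derive_rel_velocity t i k : t0 < t < T -> (i < n)%nat -> (k < d)%nat ->
  is_derive (fun s => w s i k) t (rel n m G (acc t) i k).
Proof. intros Ht Hi Hk. apply is_derive_rel; [intros; now apply Hvacc|assumption]. Qed.

Lemma is_derive_inertia t : t0 < t < T -> is_derive inertia t (inertia1 t).
Proof.
  intros Ht. eapply is_derive_eq.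
  - apply (is_derive_wdot d n g r r (w t) (w t)); intros; now apply is_derive_rel_traj.
  - unfold inertia1. rewrite (wdot_comm d n g (w t)). ring.
Qed.

Lemma is_derive_inertia1 t : t0 < t < T -> is_derive inertia1 t (inertia2 t).
Proof.
  intros Ht. apply is_derive_scal. eapply is_derive_eq.
  - apply (is_derive_wdot d n g r w (w t) (rel n m G (acc t))); intros;
      [now apply is_derive_rel_traj|now apply is_derive_rel_velocity].
  - f_equal. apply wdot_rel_rel. pose proof cluster_total_mass_pos. lra.
Qed.

Lemma rel_limit_zero i k : G i = true -> (k < d)%nat ->
  filterlim (fun t => r t i k) (at_left T) (locally 0).
Proof.
  intros Gi Hk. pose proof cluster_total_mass_pos as HM.
  apply lim_eq with (L i k - rsum n (fun j => g j * L j k) * / cmass n m G).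
  - apply (lim_minus T (fun t => traj q t i k) (fun t => ccenter n m G (traj q t) k)); [auto|].
    apply (filterlim_ext (fun t => rsum n (fun j => g j * traj q t j k) * / cmass n m G)).
    { intros t. symmetry. apply ccenter_gmass. }
    apply (lim_mult T (fun t => rsum n (fun j => g j * traj q t j k)) (fun _ => / cmass n m G));
      [|apply lim_const].
    apply (lim_rsum T n (fun j t => g j * traj q t j k)). intros j Hj.
    apply (lim_mult T (fun _ => g j) (fun t => traj q t j k)); auto using lim_const.
  - rewrite (rsum_ext n (fun j => g j * L j k) (fun j => g j * L i k)).
    + rewrite rsum_scal_r. unfold g. rewrite <- cmass_gmass. field. lra.
    + intros j Hj. unfold g, gmass. destruct (G j) eqn:Gj; [|ring].
      now rewrite (HGsame j i k).
Qed.

Lemma inertia_limit_zero : filterlim inertia (at_left T) (locally 0).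
Proof.
  apply lim_eq with (rsum n (fun _ => 0)); [|apply rsum_zero].
  apply (lim_rsum T n (fun i t => g i * rsum d (fun k => r t i k * r t i k))). intros i Hi.
  destruct (G i) eqn:Gi.
  - apply lim_eq with (g i * rsum d (fun _ => 0 * 0)).
    + apply (lim_mult T (fun _ => g i) (fun t => rsum d (fun k => r t i k * r t i k)));
        [apply lim_const|].
      apply (lim_rsum T d (fun k t => r t i k * r t i k)). intros k Hk.
      apply lim_mult; now apply rel_limit_zero.
    + rewrite rsum_eq_zero by (intros; ring). ring.
  - apply (filterlim_ext (fun _ => 0)); [|apply lim_const].
    intros t. unfold g, gmass. rewrite Gi. ring.
Qed.

(** Zero inertia would place [i0] and [j0] both at the center, a collision before [T]. *)
Lemma inertia_pos t : t0 < t < T -> 0 < inertia t.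
Proof.
  intros Ht. destruct (Rle_lt_dec (inertia t) 0) as [Hle|]; [exfalso|assumption].
  assert (Hz : forall i k, G i = true -> (k < d)%nat -> r t i k = 0).
  { intros i k Gi Hk.
    pose proof (wdot_term_le d n g (r t) i k cluster_mass_nonneg (HGn i Gi) Hk) as H1.
    fold (inertia t) in H1. pose proof (cluster_mass_pos i Gi).
    assert (0 <= r t i k * r t i k) by nra.
    assert (r t i k * r t i k = 0) by nra. nra. }
  pose proof (Hpos t i0 j0 Ht (HGn _ Hi0) (HGn _ Hj0) Hij0) as H.
  assert (E : vnorm d (fun k => traj q t i0 k - traj q t j0 k) = 0).
  { unfold vnorm. rewrite rsum_eq_zero; [apply sqrt_0|]. intros k Hk.
    pose proof (Hz i0 k Hi0 Hk) as H1. pose proof (Hz j0 k Hj0 Hk) as H2.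
    unfold r, rel in H1, H2. replace (traj q t i0 k - traj q t j0 k) with 0 by lra. ring. }
  lra.
Qed.

Lemma big_o_ext_acc i k : G i = true -> (k < d)%nat -> big_o T (fun t => ext t i k) (fun _ => 1).
Proof.
  intros Gi Hk. apply big_o_rsum. intros j Hj.
  apply big_o_ext with (fun t => gmass m (fun j => negb (G j)) j *
    (kernel d 3 (traj q t) i j * (traj q t j k - traj q t i k))); [intros; ring|].
  apply big_o_gmass. intros Gj.
  destruct (HGsep i j Gi Hj) as (l & Hl & HLl); [now destruct (G j)|].
  apply big_o_mult_1l.
  - apply big_o_kernel with l; auto.
  - apply big_o_minus; apply big_o_traj; auto.
Qed.

Lemma big_o_rel_1 i k : G i = true -> (k < d)%nat -> big_o T (fun t => r t i k) (fun _ => 1).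
Proof. intros Gi Hk. eapply big_o_lim, rel_limit_zero; auto. Qed.

(** * Cluster energy and size of the cluster *)

(** The cluster energy changes at the rate [wdot d n g (w t) (ext t)], at most the squared norms of
    [w t] and [ext t] together. The former is dominated by [S2], whose primitive [S1] is bounded;
    the latter is bounded. *)
Lemma cluster_energy_bounded :
  big_o T (fun t => / 2 * wdot d n g (w t) (w t) - pot d n g (traj q t)) (fun _ => 1).
Proof.
  pose proof cluster_total_mass_pos as HM.
  destruct kinetic_energy_dominated as (S1 & S2 & C & t1 & Ht1 & HS1 & HK & HO).
  assert (Hext : big_o T (fun t => wdot d n g (ext t) (ext t)) (fun _ => 1)).
  { apply big_o_weaken with (fun _ => 1 * 1); [intros; ring|].
    apply big_o_wdot; intros; now apply big_o_ext_acc. }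
  destruct Hext as [Ce He]. apply at_left_iff in He as (t2 & Ht2 & He).
  set (t3 := Rmax t1 t2).
  assert (Ht3 : t1 <= t3 /\ t2 <= t3 /\ t3 < T).
  { unfold t3. split; [apply Rmax_l|split; [apply Rmax_r|]]. apply Rmax_lub_lt; tauto. }
  apply (bounded_of_derive_dominated _ (fun t => wdot d n g (w t) (ext t)) S1 S2 t3 T (C + Ce)).
  - tauto.
  - intros t Ht. eapply is_derive_eq.
    + apply (is_derive_minus (fun t => / 2 * wdot d n g (w t) (w t))
               (fun t => pot d n g (traj q t))).
      * apply is_derive_scal.
        apply (is_derive_wdot d n g w w (rel n m G (acc t)) (rel n m G (acc t)));
          intros; apply is_derive_rel_velocity; auto; lra.
      * apply (is_derive_pot d n m G (traj q) (traj v t));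
          [intros; apply Hqv; auto; lra|intros; apply Hpos; auto; lra].
    + rewrite (wdot_comm d n g (rel n m G (acc t))).
      unfold w, g. rewrite (wdot_rel_rel d n m G (traj v t) (acc t)) by lra.
      (* The power of the internal forces is the same for absolute and relative velocities, so it
         cancels between kinetic and potential energy. *)
      rewrite (wdot_newton_acc_shift d n m G (traj v t) (rel n m G (traj v t)))
        by (intros; unfold rel; ring).
      match goal with |- minus ?a ?b = ?c => change (a - b = c) end.
      unfold acc, ext. field.
  - intros t Ht. apply HS1. lra.
  - intros t Ht. pose proof (wdot_Rabs_le d n g (w t) (ext t) cluster_mass_nonneg).
    pose proof (wdot_rel_le d n m G (traj v t) Hm ltac:(lra)) as H1.
    fold g (w t) in H1. pose proof (HK t ltac:(lra)).
    pose proof (He t ltac:(lra)) as H2.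
    pose proof (Rle_abs (wdot d n g (ext t) (ext t))). lra.
  - assumption.
Qed.

Lemma pot_unbounded B : at_left T (fun t => B <= pot d n g (traj q t)).
Proof.
  set (c := / 2 * (g i0 * g j0)).
  assert (Hc : 0 < c).
  { unfold c. pose proof (cluster_mass_pos i0 Hi0). pose proof (cluster_mass_pos j0 Hj0).
    apply Rmult_lt_0_compat; [lra|]. now apply Rmult_lt_0_compat. }
  (* Chosen so that the pair [i0], [j0], at a distance below [e], alone contributes more than
     [B]. *)
  set (e := c / (Rabs B + 1)).
  assert (He : 0 < e) by (apply Rdiv_lt_0_compat; [|pose proof (Rabs_pos B)]; lra).
  assert (Hlim : filterlim (fun t => vnorm d (fun k => traj q t i0 k - traj q t j0 k))
                   (at_left T) (locally 0)).
  { apply (lim_sqrt_zero T (fun t => rsum d (fun k => (traj q t i0 k - traj q t j0 k) ^ 2))).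
    apply lim_eq with (rsum d (fun _ => 0)); [|apply rsum_zero].
    apply (lim_rsum T d (fun k t => (traj q t i0 k - traj q t j0 k) ^ 2)). intros k Hk.
    apply (filterlim_ext (fun t => (traj q t i0 k - traj q t j0 k) * (traj q t i0 k - traj q t j0 k))).
    { intros t. ring. }
    assert (H : filterlim (fun t => traj q t i0 k - traj q t j0 k) (at_left T) (locally 0)).
    { apply lim_eq with (L i0 k - L j0 k); [|rewrite (HGsame i0 j0 k); auto; ring].
      apply (lim_minus T (fun t => traj q t i0 k) (fun t => traj q t j0 k)); auto. }
    apply lim_eq with (0 * 0); [|ring]. now apply lim_mult. }
  generalize (filter_and _ _ (at_left_gt T t0 HT) (at_left_lim_lt _ _ _ _ Hlim He)).
  apply filter_imp. intros t [Ht HN].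
  pose proof (Hpos t i0 j0 Ht (HGn _ Hi0) (HGn _ Hj0) Hij0) as HNpos.
  rewrite Rminus_0_r, Rabs_pos_eq in HN by lra.
  assert (Hkpos : forall i j, (i < n)%nat -> (j < n)%nat ->
    0 <= g i * g j * kernel d 1 (traj q t) i j).
  { intros i j Hi Hj. apply Rmult_le_pos.
    - apply Rmult_le_pos; now apply cluster_mass_nonneg.
    - unfold kernel. destruct (Nat.eqb_spec j i); [lra|]. left.
      apply Rinv_0_lt_compat, pow_lt. apply Hpos; auto. }
  apply Rle_trans with (c * kernel d 1 (traj q t) i0 j0).
  - unfold kernel. destruct (Nat.eqb_spec j0 i0); [congruence|]. rewrite pow_1.
    apply Rle_trans with (Rabs B + 1); [pose proof (Rle_abs B); lra|].
    set (N := vnorm d _) in *. apply Rmult_le_reg_r with N; [assumption|].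
    replace (c * / N * N) with c by (field; lra).
    replace c with ((Rabs B + 1) * e) by (unfold e; field; pose proof (Rabs_pos B); lra).
    apply Rmult_le_compat_l; [pose proof (Rabs_pos B)|]; lra.
  - unfold c, pot. rewrite Rmult_assoc. apply Rmult_le_compat_l; [lra|].
    apply Rle_trans with (rsum n (fun j => g i0 * g j * kernel d 1 (traj q t) i0 j)).
    + apply (rsum_term_le n (fun j => g i0 * g j * kernel d 1 (traj q t) i0 j) j0); auto.
    + apply (rsum_term_le n (fun i => rsum n (fun j => g i * g j * kernel d 1 (traj q t) i j)) i0);
        auto. intros i Hi. apply rsum_nonneg. auto.
Qed.

(** Lagrange-Jacobi for the cluster: [inertia2] is the squared norm of [w] plus twice the cluster
    energy plus twice the external virial, and the last two are bounded. *)
Lemma inertia2_bounds : exists C t1, 0 <= C /\ t0 <= t1 < T /\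
  forall t, t1 < t < T -> wdot d n g (w t) (w t) <= inertia2 t + C /\ 0 <= inertia2 t.
Proof.
  assert (HX : big_o T (fun t => wdot d n g (r t) (ext t)) (fun _ => 1)).
  { apply big_o_weaken with (fun _ => 1 * 1); [intros; ring|].
    apply big_o_wdot; intros; [now apply big_o_rel_1|now apply big_o_ext_acc]. }
  destruct (big_o_scal _ 2 _ _ (big_o_plus _ _ _ _ cluster_energy_bounded HX)) as [C HC].
  destruct cluster_energy_bounded as [CE HE].
  (* With the potential above this threshold and the energy at least [- CE], the squared norm of [w]
     is at least [2 * Rabs C], which absorbs the error and makes [inertia2] nonnegative. *)
  pose proof (filter_and _ _ HC (filter_and _ _ HE (pot_unbounded (Rabs C + CE)))) as H.
  apply at_left_iff in H as (t1 & Ht1 & H).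
  exists (Rabs C), (Rmax t0 t1). split; [apply Rabs_pos|].
  pose proof (Rmax_l t0 t1). pose proof (Rmax_r t0 t1).
  pose proof (Rmax_lub_lt t0 t1 T HT Ht1). split; [lra|].
  intros t Ht. destruct (H t ltac:(lra)) as (H3 & H4 & H5).
  rewrite Rmult_1_r in H3, H4. apply Rabs_le_between in H3. apply Rabs_le_between in H4.
  pose proof (Rle_abs C).
  assert (E : inertia2 t = 2 * (wdot d n g (w t) (w t) - pot d n g (traj q t)
                + wdot d n g (r t) (ext t))).
  { unfold inertia2, acc, g. rewrite wdot_newton_acc_virial.
    - unfold ext, g. ring.
    - intros; apply Hpos; auto; lra.
    - intros; unfold r, rel; ring. }
  rewrite E. pose proof (wdot_nonneg d n g (w t) cluster_mass_nonneg). split; lra.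
Qed.

(** A convex nonnegative function tending to 0 cannot increase; this is [derive_le_of_lim_zero] with
    constant 0. *)
Lemma inertia1_nonpos : exists t1, t0 <= t1 < T /\ forall t, t1 < t < T -> inertia1 t <= 0.
Proof.
  destruct inertia2_bounds as (C & t1 & HC & Ht1 & H). exists t1. split; [assumption|].
  intros t Ht. replace 0 with (0 * (T - t)) by ring.
  apply (derive_le_of_lim_zero inertia inertia1 inertia2 t1 T 0); try assumption; try lra.
  - intros; apply is_derive_inertia; lra.
  - intros; apply is_derive_inertia1; lra.
  - intros; left; apply inertia_pos; lra.
  - intros s Hs. destruct (H s Hs). lra.
  - apply inertia_limit_zero.
Qed.

(** Cauchy-Schwarz on [inertia1] together with the kinetic bound of [inertia2_bounds] supplies the
    Sundman hypothesis of [inertia_upper_bound]. *)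
Lemma big_o_inertia : big_o T inertia (fun t => Rpower (T - t) (4 / 3)).
Proof.
  destruct inertia2_bounds as (C & t1 & HC & Ht1 & H).
  destruct inertia1_nonpos as (t2 & Ht2 & H2).
  pose proof (Rmax_l t1 t2). pose proof (Rmax_r t1 t2).
  pose proof (Rmax_lub_lt t1 t2 T ltac:(lra) ltac:(lra)).
  apply (inertia_upper_bound inertia inertia1 inertia2 (Rmax t1 t2) T C); try assumption.
  - intros; apply is_derive_inertia; lra.
  - intros; apply is_derive_inertia1; lra.
  - intros; apply inertia_pos; lra.
  - intros; apply H2; lra.
  - intros t Ht. destruct (H t ltac:(lra)) as [H4 _].
    pose proof (wdot_cauchy_schwarz d n g (r t) (w t) cluster_mass_nonneg) as H5.
    fold (inertia t) in H5. unfold inertia1.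
    pose proof (inertia_pos t ltac:(lra)).
    assert (inertia t * wdot d n g (w t) (w t) <= inertia t * (inertia2 t + C))
      by (apply Rmult_le_compat_l; lra).
    nra.
  - apply inertia_limit_zero.
Qed.

(** * Tidal accelerations, torque and angular momentum *)

Lemma big_o_rel i k : G i = true -> (k < d)%nat ->
  big_o T (fun t => r t i k) (fun t => sqrt (inertia t)).
Proof.
  intros Gi Hk. pose proof (cluster_mass_pos i Gi) as Hgi.
  exists (/ sqrt (g i)). apply filter_forall. intros t.
  pose proof (wdot_term_le d n g (r t) i k cluster_mass_nonneg (HGn i Gi) Hk) as H.
  fold (inertia t) in H.
  pose proof (sqrt_lt_R0 _ Hgi).
  apply Rmult_le_reg_l with (sqrt (g i)); [assumption|].
  rewrite <- Rmult_assoc, Rinv_r, Rmult_1_l by lra.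
  rewrite <- sqrt_Rsqr_abs, <- sqrt_mult_alt by lra.
  apply sqrt_le_1_alt. assumption.
Qed.

Lemma big_o_traj_sub i j k : G i = true -> G j = true -> (k < d)%nat ->
  big_o T (fun t => traj q t i k - traj q t j k) (fun t => sqrt (inertia t)).
Proof.
  intros Gi Gj Hk. apply big_o_ext with (fun t => r t i k - r t j k).
  - intros t. unfold r, rel. ring.
  - apply big_o_minus; now apply big_o_rel.
Qed.

(** By [inv_sub_le] the difference is controlled by a difference of squared distances, which factors
    through [traj q t i' k - traj q t i k]; the remaining factors are bounded since [j] stays
    away. *)
Lemma big_o_kernel_sub i i' j : G i = true -> G i' = true -> (j < n)%nat -> G j = false ->
  big_o T (fun t => kernel d 1 (traj q t) i j - kernel d 1 (traj q t) i' j)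
          (fun t => sqrt (inertia t)).
Proof.
  intros Gi Gi' Hj Gj.
  assert (Hij : i <> j) by congruence. assert (Hij' : i' <> j) by congruence.
  pose proof (HGn i Gi) as Hi. pose proof (HGn i' Gi') as Hi'.
  destruct (HGsep i j Gi Hj Gj) as (l & Hl & HLl).
  destruct (HGsep i' j Gi' Hj Gj) as (l' & Hl' & HLl').
  apply big_o_le with (fun t =>
    (rsum d (fun k => (traj q t i' k - traj q t i k)
       * ((traj q t i' k - traj q t j k) + (traj q t i k - traj q t j k))))
    * (kernel d 1 (traj q t) i j * (kernel d 1 (traj q t) i' j * kernel d 1 (traj q t) i' j))).
  - generalize (at_left_gt T t0 HT). apply filter_imp. intros t Ht.
    pose proof (Hpos t i j Ht Hi Hj Hij) as H1.
    pose proof (Hpos t i' j Ht Hi' Hj Hij') as H2.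
    unfold kernel.
    destruct (Nat.eqb_spec j i); [congruence|]. destruct (Nat.eqb_spec j i'); [congruence|].
    rewrite !pow_1.
    eapply Rle_trans; [apply inv_sub_le; assumption|].
    rewrite !vnorm_sqr, <- rsum_minus. right. f_equal. f_equal.
    apply rsum_ext; intros k _. ring.
  - apply big_o_mult_1r.
    + apply big_o_rsum; intros k Hk. apply big_o_mult_1r; [now apply big_o_traj_sub|].
      apply big_o_plus; apply big_o_minus; now apply big_o_traj.
    + apply big_o_mult_1l; [apply big_o_kernel with l; auto|].
      apply big_o_mult_1l; apply big_o_kernel with l'; auto.
Qed.

Lemma big_o_ext_acc_sub i i' k : G i = true -> G i' = true -> (k < d)%nat ->
  big_o T (fun t => ext t i k - ext t i' k) (fun t => sqrt (inertia t)).
Proof.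
  intros Gi Gi' Hk. unfold ext, ext_acc.
  apply big_o_ext with (fun t => rsum n (fun j => gmass m (fun j => negb (G j)) j *
    (kernel d 3 (traj q t) i j * (traj q t j k - traj q t i k)
     - kernel d 3 (traj q t) i' j * (traj q t j k - traj q t i' k)))).
  { intros t. rewrite <- rsum_minus. apply rsum_ext; intros; ring. }
  apply big_o_rsum. intros j Hj. apply big_o_gmass. intros Gj.
  assert (G j = false) as Gj' by (now destruct (G j)).
  destruct (HGsep i j Gi Hj Gj') as (l & Hl & HLl).
  destruct (HGsep i' j Gi' Hj Gj') as (l' & Hl' & HLl').
  pose proof (fun p => big_o_kernel p i j l (HGn i Gi) Hj Hl ltac:(auto)) as Hker.
  pose proof (fun p => big_o_kernel p i' j l' (HGn i' Gi') Hj Hl' ltac:(auto)) as Hker'.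
  pose proof (big_o_kernel_sub i i' j Gi Gi' Hj Gj') as Hsub.
  apply big_o_mult_diff.
  - apply Hker.
  - apply big_o_minus; apply big_o_traj; auto.
  - apply big_o_ext with (fun t =>
      kernel d 1 (traj q t) i j * (kernel d 1 (traj q t) i j * kernel d 1 (traj q t) i j)
      - kernel d 1 (traj q t) i' j * (kernel d 1 (traj q t) i' j * kernel d 1 (traj q t) i' j)).
    { intros t. now rewrite <- !kernel_cube. }
    apply big_o_mult_diff; auto.
    + apply big_o_mult_1l; auto.
    + apply big_o_mult_diff; auto.
  - apply big_o_ext with (fun t => traj q t i' k - traj q t i k); [intros; ring|].
    now apply big_o_traj_sub.
Qed.

(** The velocity term is the momentum of [w] with itself and vanishes; then the acceleration of the
    center and the internal torques drop out. *)
Lemma is_derive_cluster_momentum a b t : t0 < t < T -> (a < d)%nat -> (b < d)%nat ->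
  is_derive (fun s => planar_momentum n g a b (r s) (w s)) t
    (planar_momentum n g a b (r t) (ext t)).
Proof.
  intros Ht Ha Hb. eapply is_derive_eq.
  - apply (is_derive_planar_momentum d n g a b r w (w t) (rel n m G (acc t)));
      auto; intros; [now apply is_derive_rel_traj|now apply is_derive_rel_velocity].
  - rewrite planar_momentum_self, Rplus_0_l. unfold r, g.
    etransitivity.
    { apply (planar_momentum_rel_shift n m G a b (traj q t) (acc t) (ccenter n m G (acc t))).
      pose proof cluster_total_mass_pos; lra. }
    apply planar_momentum_newton_acc. intros; unfold rel; ring.
Qed.

(** Subtracting the external acceleration of [i0] leaves the torque unchanged but turns both factors
    into quantities of order [sqrt (inertia t)]. *)
Lemma big_o_torque a b : (a < d)%nat -> (b < d)%nat ->
  big_o T (fun t => planar_momentum n g a b (r t) (ext t)) (fun t => Rpower (T - t) (4 / 3)).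
Proof.
  intros Ha Hb. apply big_o_trans with inertia; [|apply big_o_inertia].
  apply big_o_weaken with (fun t => sqrt (inertia t) * sqrt (inertia t)).
  { intros t. apply sqrt_sqrt, wdot_nonneg, cluster_mass_nonneg. }
  apply big_o_ext with (fun t => planar_momentum n g a b (r t) (fun i k => ext t i k - ext t i0 k)).
  { intros t. apply planar_momentum_rel_shift. pose proof cluster_total_mass_pos; lra. }
  apply big_o_rsum; intros i Hi. apply big_o_gmass; intros Gi.
  apply big_o_minus; apply big_o_mult; auto using big_o_rel, big_o_ext_acc_sub.
Qed.

(** A momentum staying above [e] would give [e ^ 2 <= inertia s * (inertia2 s + C)], so [inertia2]
    would dominate a positive multiple of the inverse inertia near [T]. *)
Lemma cluster_momentum_small a b e t : (a < b)%nat -> (b < d)%nat -> 0 < e -> t0 < t < T ->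
  ~ (forall s, t <= s < T -> e <= Rabs (planar_momentum n g a b (r s) (w s))).
Proof.
  intros Hab Hb He Ht Hge.
  destruct inertia2_bounds as (C & t1 & HC & Ht1 & H).
  destruct inertia1_nonpos as (t2 & Ht2 & H2).
  (* Below this value of the inertia the error [C * inertia s] is less than [e ^ 2 / 2]; the summand
     1 covers [C = 0]. *)
  assert (Hd : 0 < e ^ 2 / (2 * (C + 1))).
  { apply Rdiv_lt_0_compat; [now apply pow_lt|lra]. }
  pose proof (at_left_lim_lt _ _ _ _ inertia_limit_zero Hd) as H3.
  pose proof (filter_and _ _ (at_left_gt T t1 (proj2 Ht1))
    (filter_and _ _ (at_left_gt T t2 (proj2 Ht2))
      (filter_and _ _ (at_left_gt T t (proj2 Ht)) H3))) as H4.
  apply at_left_iff in H4 as (t3 & Ht3 & H4).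
  apply (not_second_derive_ge_inv inertia inertia1 inertia2 t3 T (e ^ 2 / 2));
    auto using inertia_limit_zero.
  - pose proof (pow_lt e 2 He). lra.
  - intros s Hs. apply is_derive_inertia. destruct (H4 s Hs) as (? & ? & ? & ?). lra.
  - intros s Hs. apply is_derive_inertia1. destruct (H4 s Hs) as (? & ? & ? & ?). lra.
  - intros s Hs. apply inertia_pos. destruct (H4 s Hs) as (? & ? & ? & ?). lra.
  - intros s Hs. apply H2. destruct (H4 s Hs) as (? & ? & ? & ?). lra.
  - intros s Hs. destruct (H4 s Hs) as (Hs1 & Hs2 & Hs3 & Hs4).
    destruct (H s Hs1) as [H5 _].
    assert (Hs0 : t0 < s < T) by lra.
    pose proof (inertia_pos s Hs0) as HIs.
    rewrite Rminus_0_r, Rabs_pos_eq in Hs4 by lra.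
    pose proof (planar_momentum_sqr_le d n g a b (r s) (w s) cluster_mass_nonneg Hab Hb) as H6.
    fold (inertia s) in H6.
    assert (H7 : e ^ 2 <= planar_momentum n g a b (r s) (w s) ^ 2).
    { rewrite <- (pow2_abs (planar_momentum n g a b (r s) (w s))).
      apply pow_incr. split; [lra|]. apply Hge. lra. }
    assert (H8 : inertia s * wdot d n g (w s) (w s) <= inertia s * (inertia2 s + C))
      by (apply Rmult_le_compat_l; lra).
    assert (H9 : inertia s * (2 * (C + 1)) < e ^ 2).
    { apply Rmult_lt_reg_r with (/ (2 * (C + 1))); [apply Rinv_0_lt_compat; lra|].
      replace (inertia s * (2 * (C + 1)) * / (2 * (C + 1))) with (inertia s) by (field; lra).
      assumption. }
    apply Rmult_le_reg_r with (inertia s); [assumption|].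
    replace (e ^ 2 / 2 / inertia s * inertia s) with (e ^ 2 / 2) by (field; lra).
    nra.
Qed.

Lemma big_o_cluster_momentum a b : (a < b)%nat -> (b < d)%nat ->
  big_o T (fun t => planar_momentum n g a b (r t) (w t)) (fun t => Rpower (T - t) (7 / 3)).
Proof.
  intros Hab Hb.
  destruct (big_o_torque a b ltac:(lia) Hb) as [C HC].
  pose proof (filter_and _ _ (at_left_gt T t0 HT) HC) as H.
  apply at_left_iff in H as (t1 & Ht1 & H).
  set (M := fun t => planar_momentum n g a b (r t) (w t)).
  set (M1 := fun t => planar_momentum n g a b (r t) (ext t)).
  assert (HM1 : forall t, t1 < t < T -> Rabs (M1 t) <= Rabs C * Rpower (T - t) (7 / 3 - 1)).
  { intros t Ht. destruct (H t Ht) as [_ H1].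
    replace (7 / 3 - 1) with (4 / 3) by field.
    eapply Rle_trans; [apply H1|]. apply Rmult_le_compat_r; [left; apply exp_pos|apply Rle_abs]. }
  (* Both signs are treated at once; an excess of [c * M] up to [T] would contradict
     [cluster_momentum_small]. *)
  assert (Hle : forall c, c ^ 2 = 1 -> forall t, t1 < t < T ->
    c * M t <= Rabs C / (7 / 3) * Rpower (T - t) (7 / 3)).
  { intros c Hc.
    assert (Hc' : Rabs c = 1).
    { assert (c = 1 \/ c = -1) as [->| ->] by nra; [apply Rabs_R1|rewrite Rabs_left; lra]. }
    apply (le_Rpower_of_derive_ge (fun t => c * M t) (fun t => c * M1 t) t1 T).
    - lra.
    - intros t Ht. apply is_derive_scal, is_derive_cluster_momentum; try lia.
      destruct (H t Ht). assumption.
    - intros t Ht. pose proof (HM1 t Ht).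
      pose proof (Rcomplements.Rabs_maj2 (c * M1 t)) as H2.
      rewrite Rabs_mult, Hc' in H2. lra.
    - apply Rabs_pos.
    - intros e t He Ht Hge. destruct (H t Ht) as [Ht0 _].
      apply (cluster_momentum_small a b e t Hab Hb He Ht0).
      intros s Hs. eapply Rle_trans; [exact (Hge s Hs)|].
      eapply Rle_trans; [apply Rle_abs|]. rewrite Rabs_mult, Hc'. unfold M. lra. }
  exists (Rabs C / (7 / 3)). apply at_left_iff. exists t1. split; [assumption|].
  intros t Ht. pose proof (Hle 1 ltac:(ring) t Ht). pose proof (Hle (-1) ltac:(ring) t Ht).
  fold (M t). apply Rabs_le. lra.
Qed.

End Collision.

(** * Transfer to the components of the cross product *)

Theorem theoremB5
  (d n : nat) (Hd : d = 2%nat \/ d = 3%nat) (Hn : (2 <= n)%nat)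
  (m : nat -> R) (Hm : forall i, (i < n)%nat -> 0 < m i)
  (t0 T : R) (HT : t0 < T)
  (q v : nat -> R -> nat -> R)
  (* q is a solution of the n-body equations on (t0, T), with velocity v *)
  (Hqv : forall i k t, (i < n)%nat -> (k < d)%nat -> t0 < t < T ->
     is_derive (fun s => q i s k) t (v i t k))
  (Hvacc : forall i k t, (i < n)%nat -> (k < d)%nat -> t0 < t < T ->
     is_derive (fun s => v i s k) t (newton_acc d n m (fun j l => q j t l) i k))
  (* no collision before T *)
  (Hnocol : forall i j t, (i < n)%nat -> (j < n)%nat -> i <> j -> t0 < t < T ->
     exists k, (k < d)%nat /\ q i t k <> q j t k)
  (* all limits L_i exist as t -> T^- *)
  (L : nat -> nat -> R)
  (HL : forall i k, (i < n)%nat -> (k < d)%nat ->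
     filterlim (fun t => q i t k) (at_left T) (locally (L i k)))
  (* G is a cluster with at least two elements *)
  (G : nat -> bool)
  (HGn : forall i, G i = true -> (i < n)%nat)
  (HG2 : exists i j, i <> j /\ G i = true /\ G j = true)
  (HGsame : forall i j k, G i = true -> G j = true -> (k < d)%nat -> L i k = L j k)
  (HGsep : forall i j, G i = true -> (j < n)%nat -> G j = false ->
     exists k, (k < d)%nat /\ L j k <> L i k) :
  (* mu0_G(t) = O(|T - t|^(7/3)) as t -> T^- *)
  (exists C delta, 0 < delta /\
     forall t, T - delta < t < T -> forall k, (k < ncross d)%nat ->
       Rabs (mu0 d n m G (fun i l => q i t l) (fun i l => v i t l) k)
         <= C * Rpower (Rabs (T - t)) (7 / 3))
  /\
  (* d/dt mu0_G(t) = O(|T - t|^(4/3)) as t -> T^- *)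
  (exists C delta, 0 < delta /\
     forall t, T - delta < t < T -> forall k, (k < ncross d)%nat ->
       exists D,
         is_derive (fun s => mu0 d n m G (fun i l => q i s l) (fun i l => v i s l) k) t D
         /\ Rabs D <= C * Rpower (Rabs (T - t)) (4 / 3)).
Proof.
  destruct HG2 as (i0 & j0 & Hij0 & Hi0 & Hj0).
  assert (Hpos : forall t i j, t0 < t < T -> (i < n)%nat -> (j < n)%nat -> i <> j ->
    0 < vnorm d (fun k => traj q t i k - traj q t j k)).
  { intros t i j Ht Hi Hj Hij. destruct (Hnocol i j t Hi Hj Hij Ht) as (k & Hk & Hne).
    apply vnorm_pos with k; [assumption|]. unfold traj. lra. }
  set (mu := fun k t => mu0 d n m G (fun i l => q i t l) (fun i l => v i t l) k).
  assert (Hpow : forall a t, t < T -> Rpower (Rabs (T - t)) a = Rpower (T - t) a).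
  { intros a t Ht. rewrite Rabs_pos_eq; [reflexivity|lra]. }
  pose proof (big_o_cluster_momentum d n m t0 T q v L Hm HT Hqv Hvacc Hpos HL G HGn
    HGsame HGsep i0 j0 Hi0 Hj0 Hij0) as Hmomentum.
  pose proof (big_o_torque d n m t0 T q v L Hm HT Hqv Hvacc Hpos HL G HGn
    HGsame HGsep i0 j0 Hi0 Hj0 Hij0) as Htorque.
  split.
  - destruct (big_o_uniform T (ncross d) mu (fun t => Rpower (T - t) (7 / 3))) as [C HC].
    { intros k Hk. destruct (mu0_planar_momentum d n m G k Hd Hk) as (a & b & s & Hab & Hb & _ & E).
      apply big_o_ext with (fun t => s * planar_momentum n (gmass m G) a b
        (rel n m G (traj q t)) (rel n m G (traj v t))).
      { intros t. symmetry. apply E. }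
      apply big_o_scal. now apply Hmomentum. }
    exists C. apply at_left_iff in HC as (t1 & Ht1 & HC). exists (T - t1). split; [lra|].
    intros t Ht k Hk. rewrite Hpow by lra. apply HC; [lra|assumption].
  (* The total operator [Derive] names the derivative for every [k] and [t], so one constant can be
     found before either is given; between [t0] and [T] it is the signed torque. *)
  - destruct (big_o_uniform T (ncross d) (fun k => Derive (mu k))
                (fun t => Rpower (T - t) (4 / 3))) as [C HC].
    { intros k Hk. destruct (mu0_planar_momentum d n m G k Hd Hk) as (a & b & s & Hab & Hb & _ & E).
      apply big_o_ext_loc with (fun t => s * planar_momentum n (gmass m G) a b
        (rel n m G (traj q t)) (ext_acc d n m G (traj q t))).
      - generalize (at_left_gt T t0 HT). apply filter_imp. intros t Ht. symmetry.
        apply is_derive_unique. eapply is_derive_ext; [intros; symmetry; apply E|].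
        apply is_derive_scal.
        apply (is_derive_cluster_momentum d n m t0 T q v Hm Hqv Hvacc G HGn i0 Hi0); auto; lia.
      - apply big_o_scal, Htorque; lia. }
    pose proof (filter_and _ _ (at_left_gt T t0 HT) HC) as H.
    apply at_left_iff in H as (t1 & Ht1 & H). exists C, (T - t1). split; [lra|].
    intros t Ht k Hk. destruct (H t ltac:(lra)) as [Ht0 Hle].
    exists (Derive (mu k) t). rewrite Hpow by lra. split; [|now apply Hle].
    apply (Derive_correct (mu k)).
    destruct (mu0_planar_momentum d n m G k Hd Hk) as (a & b & s & Hab & Hb & _ & E).
    exists (s * planar_momentum n (gmass m G) a b
      (rel n m G (traj q t)) (ext_acc d n m G (traj q t))).
    eapply is_derive_ext; [intros; symmetry; apply E|].
    apply is_derive_scal.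
    apply (is_derive_cluster_momentum d n m t0 T q v Hm Hqv Hvacc G HGn i0 Hi0); auto; lia.
Qed.
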